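(* Let $\mu$ be a good ergodic $\mathcal{R}$-invariant infinite measure on a stationary (non-simple) Bratteli diagram $B$. Then there exist stationary Bratteli diagrams $\{B_i\}_{i=1}^\infty$ and good ergodic $\mathcal{R}_i$-invariant infinite measures $\mu_i$ on $B_i$, where $\mathcal{R}_i$ is the tail equivalence relation of $B_i$, such that each measure $\mu_i$ is homeomorphic to $\mu$ and the dynamical systems $(B_i,\mathcal{R}_i)$, $(B_j,\mathcal{R}_j)$ are topologically orbit equivalent if and only if $i=j$. Moreover, the diagram $B_i$ has exactly $i$ minimal components for the tail equivalence relation $\mathcal{R}_i$, $i\in\mathbb{N}$, $i\ge1$.
   Context: Stationary Bratteli diagrams. Let $F=(f_{ij})$ be a $K\times K$ matrix of non-negative integers without zero rows or columns. The stationary Bratteli diagram $B$ with incidence matrix $F$ has levels $V_0=\{v_0\}$ and, for $k\ge1$, $V_k$ a copy of $\{1,\dots,K\}$; there is one edge from $v_0$ to each vertex of $V_1$ and, for $k\ge1$, $f_{ij}$ edges from vertex $j$ of $V_k$ to vertex $i$ of $V_{k+1}$. $X_B$ is the space of infinite paths starting at $v_0$, with topology generated by the (clopen) cylinder sets of paths with a prescribed initial segment; a cylinder set given by a path of length $N$ from $v_0$ to $i\in V_N$ is said to end in the vertex $i$ on level $N$. The tail (cofinal) equivalence relation $\mathcal{R}$ on $X_B$ relates two paths if they coincide from some level on; it is assumed aperiodic (all classes infinite). A measure is $\mathcal{R}$-invariant if for any two finite paths $e,e'$ from $v_0$ to the same vertex, replacing the initial segment $e$ by $e'$ preserves the measure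 (so cylinders ending in the same vertex of the same level have equal measure); it is ergodic if every $\mathcal{R}$-invariant Borel set is null or has null complement. Vertex classes are the strongly connected components of the directed graph on $\{1,\dots,K\}$ with $j\to i$ iff $f_{ij}>0$; $\beta\prec\alpha$ means $\beta\ne\alpha$ and there is a directed path from $\beta$ to $\alpha$. Put $A=F^T$, and let $A_\alpha$ be its restriction to $\alpha$; non-zero $A_\alpha$ are primitive (achieved by telescoping). $X_\alpha$ is the set of paths that eventually pass only through vertices of $\alpha$. The ergodic $\mathcal{R}$-invariant measures considered are the following: to a class $\alpha$ whose block has Perron–Frobenius eigenvalue $\lambda>1$ corresponds the $\mathcal{R}$-invariant measure $\mu$ (unique up to scaling) with $\mu(X_B\setminus X_\alpha)=0$ and measure $\xi_i/\lambda^{N-1}$ for each cylinder ending in $i\in\alpha$ on level $N$, where $A_\alpha\xi=\lambda\xi$, $\xi>0$. It is finite iff $\lambda$ exceeds the spectral radius of $A_\beta$ for all $\beta\prec\alpha$, and infinite otherwise. Measures are considered only on their supports, so all vertices belong to $\alpha$ or to classes $\beta\prec\alpha$ and $\mu$ is full. $\mu$ is good if for all clopen $U,V\subset X_B$ with $\mu(U)<\mu(V)$ there is a clopen $W\subset V$ with $\mu(W)=\mu(U)$. Measures $\mu_1$ on $X_1$ and $\mu_2$ on $X_2$ are homeomorphic if there is a homeomorphism $h\colon X_1\to X_2$ with $h_*\mu_1=\mu_2$. $(B_i,\mathcal{R}_i)$ and $(B_j,\mathcal{R}_j)$ are topologically orbit equivalent if there is a homeomorphism $X_{B_i}\to X_{B_j}$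 mapping $\mathcal{R}_i$-classes onto $\mathcal{R}_j$-classes. A minimal component of $\mathcal{R}_i$ is a non-empty closed $\mathcal{R}_i$-invariant subset of $X_{B_i}$ in which every $\mathcal{R}_i$-class is dense. *)

(* Defs.v *)
From HB Require Import structures.
From mathcomp Require Import all_boot all_order all_algebra.
From mathcomp Require Import all_classical all_reals all_analysis.

Set Implicit Arguments.
Unset Strict Implicit.
Unset Printing Implicit Defensive.

Import Order.TTheory GRing.Theory Num.Theory.

Local Open Scope classical_set_scope.
Local Open Scope ring_scope.

(* [inc B i j] is the number of edges from vertex j of a level k >= 1 to      *)
(* vertex i of level k + 1.  The size is a successor because measurable types *)
(* are pointed, so that the path space must be inhabited.                     *)
Record stationary_diagram := StationaryDiagram {
  rank1 : nat;
  inc : 'M[nat]_rank1.+1;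
  inc_row : forall i, exists j, inc i j != 0%N;
  inc_col : forall j, exists i, inc i j != 0%N }.

Definition vtx (B : stationary_diagram) : finType := 'I_(rank1 B).+1.

Definition edge (B : stationary_diagram) : finType :=
  {ji : vtx B * vtx B & 'I_(inc B ji.2 ji.1)}.

Definition src B (e : edge B) : vtx B := (tag e).1.
Definition tgt B (e : edge B) : vtx B := (tag e).2.

(* [x k] is the edge of x from level k + 1 to level k + 2.  The edge from v_0 *)
(* is left implicit: it is the only one from v_0 to [src (x 0)].              *)
Record bpath (B : stationary_diagram) := BPath {
  edge_at :> nat -> edge B;
  edge_atP : forall k, tgt (edge_at k) = src (edge_at k.+1) }.

(* The vertex of x on level n + 1. *)
Definition vertex B (x : bpath B) (n : nat) : vtx B := src (x n).

(* The paths with the same initial segment as p down to level n + 1.  As no   *)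
(* column of the incidence matrix is zero, every finite path from v_0 to      *)
(* level n + 1 is the initial segment of some infinite path p.                *)
Definition cylinder B (n : nat) (p : bpath B) : set (bpath B) :=
  [set x | vertex x 0 = vertex p 0 /\ forall k, (k < n)%N -> x k = p k].

HB.instance Definition _ B := gen_eqMixin (bpath B).
HB.instance Definition _ B := gen_choiceMixin (bpath B).

Lemma exists_edge B (j : vtx B) : exists e : edge B, src e = j.
Proof.
have [i] := inc_col j; rewrite -lt0n => Fij.
by exists (existT (fun ji : vtx B * vtx B => 'I_(inc B ji.2 ji.1))
                  (j, i) (Ordinal Fij)).
Qed.

Lemma exists_bpath B : exists x : bpath B, True.
Proof.
have [f fP] := choice (@exists_edge B).
unshelve eexists; last by [].
apply: (@BPath _ (fun k => iter k (f \o @tgt B) (f ord0))) => k /=.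
by rewrite fP.
Qed.

HB.instance Definition _ B := isPointed.Build (bpath B) (sval (cid (exists_bpath B))).

Lemma cylinder_cover B :
  \bigcup_(i in [set: nat * bpath B]) cylinder i.1 i.2 = [set: bpath B].
Proof. by apply/seteqP; split => // x _; exists (0%N, x). Qed.

Lemma cylinder_join B (i j : nat * bpath B) (t : bpath B) :
  [set: nat * bpath B] i -> [set: nat * bpath B] j ->
  cylinder i.1 i.2 t -> cylinder j.1 j.2 t ->
  exists k, [/\ [set: nat * bpath B] k, cylinder k.1 k.2 t &
    cylinder k.1 k.2 `<=` cylinder i.1 i.2 `&` cylinder j.1 j.2].
Proof.
case: i j => [n p] [m q] _ _ /= [p0 pP] [q0 qP].
exists (maxn n m, t); split=> // x [/= x0 xP]; split; split; rewrite ?x0 //.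
- by move=> k kn; rewrite xP ?pP // leq_max kn.
- by move=> k km; rewrite xP ?qP // leq_max km orbT.
Qed.

HB.instance Definition _ B :=
  isBaseTopological.Build (bpath B) (@cylinder_cover B) (@cylinder_join B).

(* X_B with its Borel sigma-algebra. *)
Definition borel_bpath (B : stationary_diagram) :=
  g_sigma_algebraType (@open (bpath B)).

Definition tail_equiv B (x y : bpath B) : Prop :=
  exists n, forall k, (n <= k)%N -> x k = y k.

Definition tail_class B (x : bpath B) : set (bpath B) :=
  [set y | tail_equiv x y].

Definition tail_invariant_set B (A : set (bpath B)) : Prop :=
  forall x y, tail_equiv x y -> A x -> A y.

Definition aperiodic B : Prop :=
  forall x : bpath B, infinite_set (tail_class x).

Definition reach B (v w : vtx B) : bool :=
  connect (fun j i : vtx B => (0 < inc B i j)%N) v w.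

Definition scc B (v : vtx B) : {set vtx B} :=
  [set w | reach v w && reach w v]%SET.

Definition vertex_class B (alpha : {set vtx B}) : Prop :=
  exists v, alpha = scc v.

Definition class_prec B (beta alpha : {set vtx B}) : Prop :=
  beta <> alpha /\
  exists v w, [/\ v \in beta, w \in alpha & reach v w].

(* A_alpha, the restriction of the transposed incidence matrix to alpha. *)
Definition class_block B (alpha : {set vtx B}) : 'M[nat]_#|alpha| :=
  mxsub (fun k : 'I_#|alpha| => enum_val k)
        (fun k : 'I_#|alpha| => enum_val k) (inc B)^T.

Definition primitive_mx n (M : 'M[nat]_n) : Prop :=
  exists2 m, (0 < m)%N & forall i j, (0 < (M ^+ m) i j)%N.

Definition standing_assumptions B : Prop :=
  aperiodic B /\
  forall alpha : {set vtx B}, vertex_class alpha ->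
    class_block alpha <> 0 -> primitive_mx (class_block alpha).

Definition simple_diagram B : Prop := primitive_mx (inc B).

(* X_alpha *)
Definition class_paths B (alpha : {set vtx B}) : set (bpath B) :=
  [set x | exists n, forall k, (n <= k)%N -> vertex x k \in alpha].

(* The image of A, a set of paths with a common initial segment down to level *)
(* n + 1, when this segment is replaced by the one of q.                      *)
Definition replace_segment B (n : nat) (q : bpath B) (A : set (bpath B)) :
    set (bpath B) :=
  [set y | cylinder n q y /\
           exists2 x, A x & forall k, (n <= k)%N -> y k = x k].

Section measures.
Context {R : realType} {B : stationary_diagram}.
Variable mu : {measure set (borel_bpath B) -> \bar R}.

Definition invariant_measure : Prop :=
  forall n (p q : bpath B) (A : set (borel_bpath B)),
    vertex p n = vertex q n -> measurable A -> A `<=` cylinder n p ->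
    mu (replace_segment n q A) = mu A.

Definition ergodic_measure : Prop :=
  forall A : set (borel_bpath B), measurable A -> tail_invariant_set A ->
    mu A = 0%E \/ mu (~` A) = 0%E.

(* A positive eigenvector xi makes lam the Perron-Frobenius eigenvalue of the *)
(* block; scaling xi scales mu.                                               *)
Definition class_measure (alpha : {set vtx B}) : Prop :=
  exists (lam : R) (xi : 'cV[R]_#|alpha|),
    [/\ 1 < lam,
        forall k, 0 < xi k 0,
        map_mx (fun m : nat => m%:R) (class_block alpha) *m xi = lam *: xi,
        mu (~` class_paths alpha) = 0%E &
        forall n (p : bpath B) (k : 'I_#|alpha|), vertex p n = enum_val k ->
          mu (cylinder n p) = (xi k 0 / lam ^+ n)%:E].

Definition full_measure : Prop :=
  forall U : set (bpath B), open U -> U !=set0 -> (0 < mu U)%E.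

Definition ergodic_invariant_measure : Prop :=
  [/\ invariant_measure, ergodic_measure, full_measure &
    exists alpha : {set vtx B},
      [/\ vertex_class alpha, class_measure alpha &
          forall v : vtx B, v \in alpha \/
            exists beta : {set vtx B},
              [/\ vertex_class beta, class_prec beta alpha & v \in beta]]].

Definition infinite_measure : Prop := mu setT = +oo%E.

Definition good_measure : Prop :=
  forall U V : set (bpath B), clopen U -> clopen V -> (mu U < mu V)%E ->
    exists W : set (bpath B), [/\ clopen W, W `<=` V & mu W = mu U].

End measures.

Definition homeomorphism (X Y : topologicalType) (h : X -> Y) : Prop :=
  continuous h /\
  exists g : Y -> X, [/\ cancel h g, cancel g h & continuous g].

Definition homeomorphic_measures (R : realType) (B1 B2 : stationary_diagram)
    (mu1 : {measure set (borel_bpath B1) -> \bar R})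
    (mu2 : {measure set (borel_bpath B2) -> \bar R}) : Prop :=
  exists h : bpath B1 -> bpath B2, homeomorphism h /\
    forall A : set (borel_bpath B2), measurable A -> mu2 A = mu1 (h @^-1` A).

Definition orbit_equivalent (B1 B2 : stationary_diagram) : Prop :=
  exists h : bpath B1 -> bpath B2, homeomorphism h /\
    forall x, h @` tail_class x = tail_class (h x).

Definition minimal_component B (C : set (bpath B)) : Prop :=
  [/\ C !=set0, closed C, tail_invariant_set C &
      forall x, C x -> C `<=` closure (tail_class x)].

(* Main.v *)
Require Import Defs.
From HB Require Import structures.
From mathcomp Require Import all_boot all_order all_algebra.
From mathcomp Require Import all_classical all_reals all_analysis.
From mathcomp Require Import ring.

Set Implicit Arguments.
Unset Strict Implicit.
Unset Printing Implicit Defensive.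

Import Order.TTheory GRing.Theory Num.Theory.
Import numFieldNormedType.Exports.

Local Open Scope classical_set_scope.
Local Open Scope card_scope.
Local Open Scope ring_scope.

(* Let alpha be the class carrying mu, with eigenvalue lam. All other classes *)
(* precede alpha, so alpha is terminal. Let B_i consist of a copy of alpha    *)
(* and of i sources, each with at least max(2, lam) loops and with one edge   *)
(* to every vertex of the copy: its minimal components are the i sets of      *)
(* paths that stay at a source, and their number is invariant under orbit     *)
(* equivalence. Giving measure xi_a / lam ^ n to the cylinders that end in    *)
(* the copy of a, and +oo to the others, defines a finitely additive nu on    *)
(* the clopen subsets of X_(B_i). Goodness of mu makes the values of mu and   *)
(* nu below +oo the same, each realized inside every clopen set of larger     *)
(* measure; an infinite clopen set splits into two infinite ones on both      *)
(* sides. A back-and-forth construction then yields a homeomorphism h of X_B  *)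
(* onto X_(B_i) with mu (h^-1 V) = nu V for clopen V, and mu_i is the image   *)
(* of mu under h. That mu_i is invariant and ergodic follows from uniqueness: *)
(* a measure carried by X_alpha is determined by the cylinders that end in    *)
(* alpha, and by Perron-Frobenius their measures are forced up to a factor.   *)

(** The sources change the tail relation but not the measure up to homeomorphism. The paths that
    stay at a source form a null set, and a measure notices them only because all their clopen
    neighbourhoods have measure +oo; the tail relation sees each source as a minimal component.

    That the measure does not notice more is [back_and_forth]: two finitely additive measures on
    clopen sets are homeomorphic if both are positive, split infinite sets, have the same total
    mass, and every value of one is realized inside every clopen set on which the other is larger
    ([transfers]). For mu, splitting is [eigen_measure_splits_infinite], a geometric series
    argument; for nu it follows from the two loops at a source. The finite values of nu are sums of
    numbers xi_a / lam ^ n, and these are values of mu because the values of a good infinite measure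
    are closed under addition ([clopen_valueD]); this gives [augmented_transfers_from]. In the other
    direction clopen sets below alpha are copied edge by edge ([copy_transport]), and an infinite
    target is reduced to a finite one because a source cylinder contains clopen sets of arbitrarily
    large finite measure ([source_cylinder_unbounded], where lam <= m + 2 enters). This gives
    [augmented_transfers_to].

    A homeomorphism need not respect tail classes, so the invariance and ergodicity of the image
    measure are derived from its values on cylinders alone. [measure_eq_on_class] says that these
    determine it; comparing a measure with its image under a change of initial segment gives
    [eigen_measure_invariant], and comparing its restriction to an invariant set with a multiple of
    itself gives [eigen_measure_ergodic], the multiple coming from [eigen_sequence_unique]. The
    diagrams are told apart by [card_minimal_components] and
    [orbit_equivalent_minimal_components]. *)

(** * Cylinders and clopen sets *)

Section path_space.
Context {B : stationary_diagram}.
Implicit Types (x y z p q : bpath B) (U V : set (bpath B)).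

Lemma bpath_ext x y : (forall k, x k = y k) -> x = y.
Proof.
case: x y => [f fP] [g gP] /= /funext fg; subst g.
by congr BPath; exact: Prop_irrelevance.
Qed.

Lemma vertexS x n : vertex x n.+1 = tgt (x n).
Proof. by rewrite /vertex edge_atP. Qed.

Lemma cyl_refl n x : cylinder n x x.
Proof. by []. Qed.

Lemma cyl_sym n x y : cylinder n x y -> cylinder n y x.
Proof. by move=> [h0 h]; split => // k kn; rewrite h. Qed.

Lemma cyl_trans n x y z : cylinder n x y -> cylinder n y z -> cylinder n x z.
Proof.
by move=> [h0 h] [h0' h']; split; [rewrite h0'|move=> k kn; rewrite h' ?h].
Qed.

Lemma cyl_eq n x y : cylinder n x y -> cylinder n x = cylinder n y.
Proof.
move=> xy; apply/seteqP; split=> z; last exact: cyl_trans.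
by apply: cyl_trans; exact: cyl_sym.
Qed.

Lemma cyl_le m n x : (m <= n)%N -> cylinder n x `<=` cylinder m x.
Proof. by move=> mn y [h0 h]; split=> // k km; apply: h; exact: leq_trans mn. Qed.

Lemma cyl_vertex n x y : cylinder n x y -> vertex y n = vertex x n.
Proof. by case: n => [[]//|n [_ h]]; rewrite !vertexS h. Qed.

Lemma cylS n x y : cylinder n.+1 x y <-> cylinder n x y /\ y n = x n.
Proof.
split=> [xy|[[h0 h] e]]; first by split; [exact: cyl_le xy|case: xy => _ ->].
by split=> // k; rewrite ltnS leq_eqVlt => /predU1P[->|/h].
Qed.

Lemma cyl_prefix n x y : (0 < n)%N -> (forall k, (k < n)%N -> y k = x k) ->
  cylinder n x y.
Proof. by move=> n0 h; split=> //; rewrite /vertex h. Qed.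

Lemma openP U : open U <-> forall x, U x -> exists n, cylinder n x `<=` U.
Proof.
split=> [[D _ <-] x [[n p] Di /= px]|h].
  by exists n => y xy; exists (n, p) => //=; exact: cyl_trans xy.
exists [set i | cylinder i.1 i.2 `<=` U] => //.
apply/seteqP; split=> [x [i]/= iU /iU //|x /h[n nU]].
by exists (n, x).
Qed.

(** Membership in a clopen set is locally constant. The level n depends on x here; a uniform one is
    provided by [clopen_of_level]. *)
Lemma clopenP U :
  clopen U <-> forall x, exists n, forall y, cylinder n x y -> (U y <-> U x).
Proof.
split=> [[/openP oU]|h].
  rewrite -openC => /openP cU x; have [Ux|nUx] := pselect (U x).
    by have [n nU] := oU _ Ux; exists n => y /nU.
  by have [n nU] := cU _ nUx; exists n => y /nU.
split; first by apply/openP => x Ux; have [n nU] := h x; exists n => y /nU[_]; exact.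
rewrite -openC; apply/openP => x Ux; have [n nU] := h x.
by exists n => y /nU[yx _] /yx.
Qed.

Lemma clopen_cylinder n p : clopen (cylinder n p).
Proof.
by apply/clopenP => x; exists n => y xy; split => h;
  [apply: cyl_trans h (cyl_sym xy)|exact: cyl_trans xy].
Qed.

Lemma clopen_edge n (e : edge B) : clopen [set x : bpath B | x n = e].
Proof.
by apply/clopenP => x; exists n.+1 => y [_ h] /=; rewrite h.
Qed.

Lemma clopenD U V : clopen U -> clopen V -> clopen (U `\` V).
Proof. by move=> cU cV; rewrite setDE; apply: clopenI => //; exact: clopenC. Qed.

(** Stationarity allows the tail of x to be attached at a level different from its own;
    [move_segment] relies on this. *)
Lemma splice n p m x : vertex p n = vertex x m ->
  exists z, cylinder n p z /\ forall k, z (n + k)%N = x (m + k)%N.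
Proof.
move=> pv; pose f k := if (k < n)%N then p k else x (m + (k - n))%N.
have fP k : tgt (f k) = src (f k.+1).
  rewrite /f; have [kn|nk] := ltnP k n; have [kn'|nk'] := ltnP k.+1 n.
  - exact: edge_atP.
  - have e : k.+1 = n by apply/eqP; rewrite eqn_leq kn nk'.
    by rewrite e subnn addn0 -[RHS]pv -e vertexS.
  - by rewrite ltnNge (leq_trans nk) in kn'.
  - by rewrite subSn // addnS edge_atP.
exists (BPath fP); split; last by move=> k /=; rewrite /f ltnNge leq_addr /= addKn.
split; last by move=> k kn /=; rewrite /f kn.
rewrite /vertex /= /f; case: n pv {fP f} => [|n _] //=.
by rewrite addn0.
Qed.

Lemma graft n p (e : edge B) : src e = vertex p n ->
  exists z, cylinder n p z /\ z n = e.
Proof.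
move=> ev; have [f fP] := choice (@exists_edge B).
pose x := @BPath B (fun k => iter k (f \o @tgt B) e) (fun k => esym (fP _)).
have [|z [pz zx]] := @splice n p 0 x; first by rewrite -ev.
by exists z; split=> //; rewrite -[n]addn0 zx.
Qed.

Lemma exists_path_from (v : vtx B) : exists x, vertex x 0 = v.
Proof.
have [e ev] := exists_edge v; have [f fP] := choice (@exists_edge B).
by exists (@BPath B (fun k => iter k (f \o @tgt B) e) (fun k => esym (fP _))).
Qed.

Lemma exists_path_to n (v : vtx B) : exists x, vertex x n = v.
Proof.
elim: n v => [|n IH] v; first exact: exists_path_from.
have [j Fvj] := inc_row v; rewrite -lt0n in Fvj.
have [x xj] := IH j.
pose e : edge B := existT (fun ji : vtx B * vtx B => 'I_(inc B ji.2 ji.1))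
  (j, v) (Ordinal Fvj).
have [z [xz ze]] := @graft n x e (esym xj).
by exists z; rewrite vertexS ze.
Qed.

(** Dependent choice in the tree of finite paths: P k is a property of cylinders of level k, and one
    that always passes to some child holds along a whole branch. *)
Lemma konig (P : nat -> bpath B -> Prop) n x :
  (forall k y z, cylinder k y z -> P k y -> P k z) ->
  (forall k y, P k y -> exists2 z, cylinder k y z & P k.+1 z) ->
  P n x -> exists2 z, cylinder n x z & forall k, (n <= k)%N -> P k z.
Proof.
move=> Pcyl Pext Pnx.
have /choice[f fP] (ky : nat * bpath B) : exists z, P ky.1 ky.2 ->
    cylinder ky.1 ky.2 z /\ P ky.1.+1 z.
  have [/Pext[z ? ?]|] := pselect (P ky.1 ky.2); first by exists z.
  by exists point.
pose s := fix s j := if j is j'.+1 then f ((n + j')%N, s j') else x.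
have Ps j : P (n + j)%N (s j).
  by elim: j => [|j IH] /=; [rewrite addn0|rewrite addnS; exact: (fP (_, _) IH).2].
have ss j : cylinder (n + j) (s j) (s j.+1) by exact: (fP (_, _) (Ps j)).1.
have sle i j : (i <= j)%N -> cylinder (n + i) (s i) (s j).
  move=> /subnK <-; elim: (j - i)%N => [|k IH] //.
  apply: cyl_trans IH _; apply: cyl_le (ss _).
  by rewrite leq_add2l leq_addl.
have sE i j k : (k < n + i)%N -> (k < n + j)%N -> s i k = s j k.
  move=> ki kj; have [ij|/ltnW ij] := leqP i j.
    by rewrite (sle _ _ ij).2.
  by rewrite (sle _ _ ij).2.
(* Edge k is read off stage k + 1, which has already fixed all edges below n + k + 1. *)
pose z k := s k.+1 k.
have kn k j : (j <= k.+1)%N -> (j <= n + k.+1)%N.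
  by move=> h; rewrite (leq_trans h) // leq_addl.
have zP k : tgt (z k) = src (z k.+1).
  by rewrite /z (sE k.+1 k.+2) ?kn // edge_atP.
have zs j : cylinder (n + j) (s j) (BPath zP).
  have zk k : (k < n + j)%N -> BPath zP k = s j k by move=> h; apply: sE; rewrite ?kn.
  split; last exact: zk.
  have [nj|nj] := posnP (n + j); last by rewrite /vertex zk.
  move: nj => /eqP; rewrite addn_eq0 => /andP[/eqP n0 /eqP j0].
  rewrite /vertex /= /z; have := (sle 0 1 isT)%N; rewrite j0 /= => -[+ _].
  by rewrite /vertex.
exists (BPath zP); first by have := zs 0%N; rewrite addn0.
by move=> k /subnKC <-; exact: Pcyl (zs _) (Ps _).
Qed.

(** The fibres of c cut U into finitely many disjoint clopen pieces, which are put together again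
    one by one. *)
Lemma clopen_split_ind (T : finType) (c : bpath B -> T) (P : set (bpath B) -> Prop) U :
  (forall t, clopen [set x | c x = t]) -> clopen U -> P set0 ->
  (forall V W, clopen V -> clopen W -> V `&` W = set0 -> P V -> P W ->
    P (V `|` W)) ->
  (forall t, P (U `&` [set x | c x = t])) -> P U.
Proof.
move=> cc cU P0 PU Pt.
suff H (s : seq T) : uniq s -> clopen (U `&` [set x | c x \in s]) /\
    P (U `&` [set x | c x \in s]).
  have [_] := H _ (enum_uniq T).
  by rewrite (_ : [set x | c x \in enum T] = setT) ?setIT //; apply/seteqP; split=> x //= _; rewrite mem_enum.
elim: s => [_|t s IH /= /andP[ts /IH[cs Ps]]].
  have -> : U `&` [set x | c x \in [::]] = set0 by apply/seteqP; split=> x // [].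
  by split=> //; exact: clopen0.
have -> : U `&` [set x | c x \in t :: s] =
    (U `&` [set x | c x = t]) `|` (U `&` [set x | c x \in s]).
  rewrite -setIUr; congr (_ `&` _); apply/seteqP; split=> x /=; rewrite inE.
    by case/predU1P; [left|right].
  by case=> [->|->]; rewrite ?eqxx ?orbT.
have ct : clopen (U `&` [set x | c x = t]) by exact: clopenI.
split; first exact: clopenU.
apply: PU => //; rewrite setIACA setIid (_ : _ `&` [set x | _ \in s] = set0) ?setI0//.
by apply/seteqP; split=> x //= [xt xs]; move: ts; rewrite -xt xs.
Qed.

Lemma clopen_vertex0 (v : vtx B) : clopen [set x : bpath B | vertex x 0 = v].
Proof. by apply/clopenP => x; exists 0%N => y [/= -> _]. Qed.

(** Compactness as an induction principle. If P fails for U, it fails for the trace of U on some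
    cylinder of level 0, then on one of its children, and so on along a path z; but a small cylinder
    around z lies inside U or misses it. *)
Lemma clopen_ind (P : set (bpath B) -> Prop) U : clopen U -> P set0 ->
  (forall V W, clopen V -> clopen W -> V `&` W = set0 -> P V -> P W ->
    P (V `|` W)) ->
  (forall n p, cylinder n p `<=` U -> P (cylinder n p)) -> P U.
Proof.
move=> cU P0 PU Pc; apply: contrapT => nPU.
have [x nPx] : exists x, ~ P (U `&` cylinder 0 x).
  apply: contrapT => /forallNP nPx; apply: nPU.
  apply: (@clopen_split_ind _ (@vertex B ^~ 0%N) P) => // v; first exact: clopen_vertex0.
  have [x xv] := exists_path_from v.
  rewrite (_ : [set y | vertex y 0 = v] = cylinder 0 x); last by rewrite -xv; apply/seteqP; split=> y // [].
  exact: contrapT (nPx x).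
have [||//|z _ nPz] := @konig (fun n x => ~ P (U `&` cylinder n x)) 0 x.
- by move=> k y z /cyl_eq ->.
- move=> k y nPy; apply: contrapT => nz; apply: nPy.
  have ck : clopen (U `&` cylinder k y) by apply: clopenI => //; exact: clopen_cylinder.
  apply: (@clopen_split_ind _ (fun x => x k) P) => // e; first exact: clopen_edge.
  have [ev|ev] := eqVneq (src e) (vertex y k).
    have [z [yz ze]] := graft ev.
    rewrite (_ : _ `&` [set x : bpath B | x k = e] = U `&` cylinder k.+1 z).
      by apply: contrapT => nPz; apply: nz; exists z.
    rewrite -setIA; congr (_ `&` _); apply/seteqP; split=> w /=.
      by move=> [yw we]; apply/cylS; split; [apply: cyl_trans yw; exact: cyl_sym|rewrite ze].
    by move=> /cylS[zw ->]; split=> //; exact: cyl_trans zw.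
  rewrite (_ : _ `&` [set x : bpath B | x k = e] = set0) //; apply/seteqP; split=> w //= [[_ yw] we].
  by move: ev; rewrite -we -(cyl_vertex yw) eqxx.
have /clopenP /(_ z)[n nU] := cU.
apply: (nPz n) => //; have [Uz|nUz] := pselect (U z).
  by rewrite (_ : U `&` _ = cylinder n z);
    [apply: Pc => y /nU[_]; exact|apply/setIidPr => y /nU[_]; exact].
rewrite (_ : U `&` _ = set0) //.
by apply/seteqP; split=> y // [Uy /nU[/(_ Uy)]].
Qed.

Section clopen_content.
Context {R : realType}.
Implicit Types m : set (bpath B) -> \bar R.

(** Although m is a function of all sets, its value is constrained only on the clopen ones. *)
Definition clopen_content m := [/\ m set0 = 0%E, forall U, clopen U -> (0 <= m U)%E &
  forall U V, clopen U -> clopen V -> U `&` V = set0 ->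
    m (U `|` V) = (m U + m V)%E].

Section content_theory.
Variable m : set (bpath B) -> \bar R.
Hypothesis mc : clopen_content m.

Lemma content0 : m set0 = 0%E. Proof. by case: mc. Qed.

Lemma content_ge0 U : clopen U -> (0 <= m U)%E. Proof. by case: mc => _ + _; exact. Qed.

Lemma contentU U V : clopen U -> clopen V -> U `&` V = set0 ->
  m (U `|` V) = (m U + m V)%E.
Proof. by case: mc => _ _; exact. Qed.

Lemma content_setID U V : clopen U -> clopen V ->
  m U = (m (U `&` V) + m (U `\` V))%E.
Proof.
move=> cU cV; rewrite -contentU; last by rewrite setDE setIACA setIid setICr setI0.
- by rewrite setUIDK.
- exact: clopenI.
- exact: clopenD.
Qed.

Lemma content_setD U V : clopen U -> clopen V -> V `<=` U ->
  m U = (m V + m (U `\` V))%E.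
Proof. by move=> cU cV VU; rewrite (content_setID cU cV) (setIidr VU). Qed.

Lemma le_content U V : clopen U -> clopen V -> U `<=` V -> (m U <= m V)%E.
Proof.
move=> cU cV UV; rewrite (content_setD cV cU UV) leeDl //.
by apply: content_ge0; exact: clopenD.
Qed.

Lemma content_sum (T : finType) (c : bpath B -> T) U :
  (forall t, clopen [set x | c x = t]) -> clopen U ->
  m U = (\sum_t m (U `&` [set x | c x = t]))%E.
Proof.
move=> cc cU; pose P V := V `<=` U ->
  clopen V /\ m V = (\sum_t m (V `&` [set x | c x = t]))%E.
suff : P U by case.
apply: (@clopen_split_ind _ c P) => //.
- move=> _; split; first exact: clopen0.
  by rewrite content0 big1// => t _; rewrite set0I content0.
- move=> V W cV cW VW PV PW VWU; split; first exact: clopenU.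
  rewrite contentU // (PV _).2; last by apply: subset_trans VWU; exact: subsetUl.
  rewrite (PW _).2; last by apply: subset_trans VWU; exact: subsetUr.
  rewrite -big_split/=; apply: eq_bigr => t _.
  rewrite setIUl contentU //; [exact: clopenI|exact: clopenI|].
  by rewrite setIACA VW set0I.
- move=> t _; split; first exact: clopenI.
  rewrite (bigD1 t) //= -setIA setIid big1 ?adde0 // => s st.
  rewrite -setIA (_ : _ `&` [set x | c x = s] = set0) ?setI0 ?content0 //.
  by apply/seteqP; split=> x //= [-> ts]; rewrite ts eqxx in st.
Qed.

Lemma content_sum_edge n p U : clopen U -> U `<=` cylinder n p ->
  m U = (\sum_(e | src e == vertex p n) m (U `&` [set x : bpath B | x n = e]))%E.
Proof.
move=> cU Up; rewrite (@content_sum _ (fun x => x n)) //; last exact: clopen_edge.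
rewrite [RHS]big_mkcond/=; apply: eq_bigr => e _; case: eqVneq => // ev.
rewrite (_ : _ `&` _ = set0) ?content0//; apply/seteqP; split=> x //= [/Up px xe].
by move: ev; rewrite -xe -(cyl_vertex px) eqxx.
Qed.

End content_theory.
End clopen_content.

Lemma cylinder_edge n p z : cylinder n p z ->
  cylinder n p `&` [set x : bpath B | x n = z n] = cylinder n.+1 z.
Proof.
move=> pz; apply/seteqP; split=> x /=.
  by move=> [px xz]; apply/cylS; split=> //; apply: cyl_trans px; exact: cyl_sym.
by move=> /cylS[zx ->]; split=> //; exact: cyl_trans zx.
Qed.

End path_space.

Lemma closure_cylinder (C : stationary_diagram) (A : set (bpath C)) y :
  closure A y <-> forall n, exists x, A x /\ cylinder n y x.
Proof.
split=> [Ay n|h U].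
  have [|x [Ax yx]] := Ay (cylinder n y); last by exists x.
  by apply: open_nbhs_nbhs; split => //; case: (clopen_cylinder n y).
rewrite nbhsE => -[V [/openP oV Vy] VU].
by have [n nV] := oV _ Vy; have [x [Ax /nV Vx]] := h n; exists x; split=> //; exact: VU.
Qed.

Lemma closure_sub_closed (C : stationary_diagram) (A D : set (bpath C)) :
  closed D -> A `<=` D -> closure A `<=` D.
Proof. by move=> cD AD; rewrite ((closure_id D).1 cD); exact: closure_subset. Qed.

(** * Finitely additive measures from vertex weights *)

Section weight_content.
Context {R : realType} {B : stationary_diagram}.
Variable w : nat -> vtx B -> \bar R.
Hypothesis w_ge0 : forall n v, (0 <= w n v)%E.
Hypothesis w_sum : forall n v,
  (w n v = \sum_(e : edge B | src e == v) w n.+1 (tgt e))%E.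
Implicit Types (x y z p q : bpath B) (U V : set (bpath B)).

Definition extend n q (e : edge B) : bpath B :=
  get [set z : bpath B | cylinder n q z /\ z n = e].

Lemma extendP n q e : src e = vertex q n ->
  cylinder n q (extend n q e) /\ extend n q e n = e.
Proof.
by move=> /graft zP; exact: (@getPex _ [set z | cylinder n q z /\ z n = e] zP).
Qed.

(* The total weight of the cylinders of level n + k below cylinder n q whose  *)
(* representative path lies in U; it is independent of the representatives    *)
(* and of k when U is a union of cylinders of level n + k.                    *)
Fixpoint weight_at k n q U : \bar R :=
  if k is k'.+1 then
    (\sum_(e : edge B | src e == vertex q n) weight_at k' n.+1 (extend n q e) U)%E
  else if `[< U q >] then w n (vertex q n) else 0%E.

Definition of_level N U := forall x y, cylinder N x y -> (U x <-> U y).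

Lemma of_level_le M N U : (M <= N)%N -> of_level M U -> of_level N U.
Proof. by move=> MN h x y xy; apply: h; exact: cyl_le xy. Qed.

Lemma of_level_clopen N U : of_level N U -> clopen U.
Proof. by move=> h; apply/clopenP => x; exists N => y /h[]. Qed.

Lemma of_level_cylinder n p : of_level n (cylinder n p).
Proof. by move=> x y xy; split=> h; [exact: cyl_trans h xy|exact: cyl_trans h (cyl_sym xy)]. Qed.

(** Cylinders have a level and a union takes the larger one, so [clopen_ind] yields the uniform
    level. *)
Lemma clopen_of_level U : clopen U -> exists N, of_level N U.
Proof.
move=> cU; apply: (@clopen_ind B (fun U => exists N, of_level N U)) => //.
- by exists 0%N.
- move=> V W _ _ _ [M hM] [N hN]; exists (maxn M N) => x y xy.
  have := hM _ _ (cyl_le (leq_maxl M N) xy).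
  have := hN _ _ (cyl_le (leq_maxr M N) xy).
  by rewrite /setU /=; tauto.
- by move=> n p _; exists n; exact: of_level_cylinder.
Qed.

Lemma vertex_extend n q e : src e = vertex q n -> vertex (extend n q e) n.+1 = tgt e.
Proof. by move=> /extendP[_ h]; rewrite vertexS h. Qed.

Lemma weight_at_step k n q U : of_level (n + k) U ->
  weight_at k.+1 n q U = weight_at k n q U.
Proof.
elim: k n q => [|k IH] n q lU.
  rewrite /= addn0 in lU *; case: ifPn => Uq.
    rewrite w_sum; apply: eq_bigr => e /eqP ev.
    have [qz _] := extendP ev; rewrite vertex_extend //.
    by rewrite -(asbool_equiv_eq (lU _ _ qz)) Uq.
  rewrite big1// => e /eqP ev; have [qz _] := extendP ev.
  by rewrite -(asbool_equiv_eq (lU _ _ qz)) (negPf Uq).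
rewrite /= -/(weight_at k.+1 _ _ _); apply: eq_bigr => e _.
by rewrite -[LHS]/(weight_at k.+1 _ _ _) IH // addSnnS.
Qed.

Lemma weight_at_level k m n q U : of_level (n + k) U -> (k <= m)%N ->
  weight_at m n q U = weight_at k n q U.
Proof.
move=> lU /subnK <-; elim: (m - k)%N => [|j IH] //.
rewrite addSn weight_at_step // addnA.
by apply: of_level_le lU; rewrite -addnA leq_add2l leq_addl.
Qed.

Lemma weight_at_ge0 k n q U : (0 <= weight_at k n q U)%E.
Proof.
elim: k n q => [|k IH] n q /=; first by case: ifP.
by apply: sume_ge0.
Qed.

Lemma weight_atU k n q U V : U `&` V = set0 ->
  weight_at k n q (U `|` V) = (weight_at k n q U + weight_at k n q V)%E.
Proof.
move=> UV; elim: k n q => [|k IH] n q /=.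
  rewrite asbool_or; case: asboolP => Uq; case: asboolP => Vq; rewrite ?adde0 ?add0e//.
  by have : (U `&` V) q by []; rewrite UV.
by rewrite -big_split/=; apply: eq_bigr => e _.
Qed.

Lemma weight_at_disj k n q U : cylinder n q `&` U = set0 -> weight_at k n q U = 0%E.
Proof.
elim: k n q => [|k IH] n q qU /=.
  by case: asboolP => // Uq; have : (cylinder n q `&` U) q by []; rewrite qU.
rewrite big1// => e /eqP ev; rewrite IH//; have [qz ze] := extendP ev.
apply/seteqP; split=> x // [/(cyl_le (leqnSn n)) zx Ux]; rewrite -qU.
by split=> //; exact: cyl_trans zx.
Qed.

Lemma weight_at_cylinder m j p q : cylinder j q p ->
  weight_at m j q (cylinder (j + m) p) = w (j + m) (vertex p (j + m)).
Proof.
elim: m j q => [|m IH] j q qp /=.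
  by rewrite addn0 (asboolT (cyl_sym qp)) (cyl_vertex qp).
have ev : src (p j) = vertex q j by rewrite -(cyl_vertex qp).
rewrite (bigD1 (p j)) ?ev//= big1 ?adde0; last first.
  move=> e /andP[/eqP eq ep]; apply: weight_at_disj.
  have [qz ze] := extendP eq.
  apply/seteqP; split=> x // -[/cylS[_]]; rewrite ze => xe.
  by move=> [_ /(_ j)]; rewrite addnS ltnS leq_addr xe => /(_ isT) ep'; rewrite ep' eqxx in ep.
have [qz ze] := extendP ev.
rewrite -addSnnS IH//; apply/cylS; split=> //.
by apply: cyl_trans qp; exact: cyl_sym.
Qed.

Definition start (v : vtx B) : bpath B := get [set x : bpath B | vertex x 0 = v].

Lemma startP v : vertex (start v) 0 = v.
Proof. exact: (getPex (exists_path_from v)). Qed.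

(** Any level of U gives the same value, by [weight_contentE]; a set without a level gets a
    meaningless one. *)
Definition weight_content U : \bar R :=
  (\sum_v weight_at (get [set N | of_level N U]) 0 (start v) U)%E.

Lemma weight_contentE N U : of_level N U ->
  weight_content U = (\sum_v weight_at N 0 (start v) U)%E.
Proof.
move=> lU; rewrite /weight_content; set M := get _.
have lM : of_level M U by apply: (@getPex _ [set N | of_level N U] (ex_intro _ N lU)).
apply: eq_bigr => v _; have [MN|/ltnW NM] := leqP M N.
  by rewrite (@weight_at_level M N).
by rewrite (@weight_at_level N M).
Qed.

Lemma weight_contentP : clopen_content weight_content.
Proof.
split.
- rewrite (@weight_contentE 0) // big1 // => v _; apply: weight_at_disj.
  by rewrite setI0.
- by move=> U _; apply: sume_ge0 => v _; exact: weight_at_ge0.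
- move=> U V /clopen_of_level[M lU] /clopen_of_level[N lV] UV.
  have lU' := of_level_le (leq_maxl M N) lU.
  have lV' := of_level_le (leq_maxr M N) lV.
  rewrite !(@weight_contentE (maxn M N)) //.
    by rewrite -big_split; apply: eq_bigr => v _; exact: weight_atU.
  by move=> x y xy; move: (lU' _ _ xy) (lV' _ _ xy); rewrite /setU /=; tauto.
Qed.

Lemma weight_content_cylinder n p :
  weight_content (cylinder n p) = w n (vertex p n).
Proof.
rewrite (weight_contentE (@of_level_cylinder n p)).
rewrite (bigD1 (vertex p 0)) //= big1 ?adde0.
  by rewrite -[X in cylinder X](add0n n) weight_at_cylinder //; split=> //; rewrite startP.
move=> v vp; apply: weight_at_disj; apply/seteqP; split=> x // [[xv _] [xp _]].
by move: vp; rewrite -xp xv startP eqxx.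
Qed.

End weight_content.

(** * Back and forth between good finitely additive measures *)

Lemma addeI {R : realDomainType} (x a b : \bar R) :
  x \is a fin_num -> (x + a = x + b)%E -> a = b.
Proof. by move=> fx ab; apply/le_anti; rewrite -(leeD2lE a b fx) -(leeD2lE b a fx) ab lexx. Qed.

Section matching.
Context {R : realType}.

Section relations.
Context {B : stationary_diagram}.
Variable m : set (bpath B) -> \bar R.

Definition positive_content := forall U, clopen U -> m U = 0%E -> U = set0.

(** Excludes infinite atoms: an infinite set matched with a union of two infinite sets has to be cut
    accordingly. *)
Definition splits_infinite := forall U, clopen U -> m U = +oo%E ->
  exists V, [/\ clopen V, V `<=` U, m V = +oo%E & m (U `\` V) = +oo%E].

End relations.

(** For m1 = m2 this is goodness; between two contents it also makes values of m1 values of m2. *)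
Definition transfers {B1 B2 : stationary_diagram}
    (m1 : set (bpath B1) -> \bar R) (m2 : set (bpath B2) -> \bar R) :=
  forall U V, clopen U -> clopen V -> (m1 U < m2 V)%E ->
    exists W, [/\ clopen W, W `<=` V & m2 W = m1 U].

(** If one of the two parts of P is finite, it is transferred into Q and the other part is matched
    by subtraction. If both are infinite, Q is split into two infinite sets. *)
Lemma split_matching {B1 B2 : stationary_diagram}
    (m1 : set (bpath B1) -> \bar R) (m2 : set (bpath B2) -> \bar R) P Q A :
  clopen_content m1 -> clopen_content m2 -> positive_content m1 ->
  splits_infinite m2 -> transfers m1 m2 -> clopen P -> clopen Q -> clopen A ->
  m1 P = m2 Q -> exists C, [/\ clopen C, m1 (P `&` A) = m2 (Q `&` C) &
                              m1 (P `\` A) = m2 (Q `\` C)].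
Proof.
move=> c1 c2 pos1 spl2 tr cP cQ cA PQ.
have fin A' : clopen A' -> (m1 (P `&` A') < +oo)%E ->
    exists C, [/\ clopen C, m1 (P `&` A') = m2 (Q `&` C) &
                  m1 (P `\` A') = m2 (Q `\` C)].
  move=> cA' foo; have cPA := clopenI cP cA'; have cPD := clopenD cP cA'.
  have a0 := content_ge0 c1 cPA.
  have [D0|D0] := eqVneq (m1 (P `\` A')) 0%E.
    exists setT; split; first exact: clopenT.
    - by rewrite setIT -PQ [RHS](content_setID c1 cP cA') D0 adde0.
    - by rewrite setDT D0 (content0 c2).
  have [|W [cW WQ mW]] := tr _ Q cPA cQ.
    rewrite -PQ [ltRHS](content_setID c1 cP cA') lteDl ?ge0_fin_numE //.
    by rewrite lt0e D0 content_ge0.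
  exists W; split; rewrite ?(setIidr WQ)//.
  have := PQ; rewrite (content_setD c2 cQ cW WQ) (content_setID c1 cP cA') mW.
  by apply: addeI; rewrite ge0_fin_numE.
have [/fin|] := ltP (m1 (P `&` A)) +oo%E; first exact.
rewrite leye_eq => /eqP Aoo.
have [Doo|] := ltP (m1 (P `\` A)) +oo%E.
  have [||C [cC h1 h2]] := fin (~` A); [exact: clopenC|by rewrite -setDE|].
  exists (~` C); split; first exact: clopenC.
    by move: h2; rewrite !setDE setCK.
  by rewrite setDE h1 setDE setCK.
rewrite leye_eq => /eqP Doo.
have [|V [cV VQ Voo QVoo]] := spl2 _ cQ.
  by rewrite -PQ (content_setID c1 cP cA) Aoo Doo.
by exists V; split=> //; rewrite ?(setIidr VQ) ?Aoo ?Doo ?Voo ?QVoo.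
Qed.

Section code.
Context {B : stationary_diagram}.
Implicit Types (l : seq (set (bpath B))) (x : bpath B).

(** The bit string names the cell of x in the finite partition generated by l. *)
Definition code l x : seq bool := [seq `[< A x >] | A <- l].

Definition all_clopen l := foldr (fun A Q => clopen A /\ Q) True l.

Lemma clopen_code l t : all_clopen l -> clopen [set x | code l x = t].
Proof.
move=> cl; apply/clopenP => x.
have [n nE] : exists n, forall y, cylinder n x y -> code l y = code l x.
  elim: l cl {t} => [|A l IH] /=; first by exists 0%N.
  move=> [/clopenP/(_ x)[n nA] /IH[k kE]].
  exists (maxn n k) => y xy; congr (_ :: _).
    exact/asbool_equiv_eq/nA/(cyl_le (leq_maxl n k)).
  exact/kE/(cyl_le (leq_maxr n k)).
by exists n => y /nE /= ->.
Qed.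

End code.

Section matched.
Context {B1 B2 : stationary_diagram}.
Variables (m1 : set (bpath B1) -> \bar R) (m2 : set (bpath B2) -> \bar R).

Definition matched l1 l2 := [/\ all_clopen l1, all_clopen l2 &
  forall t, m1 [set x | code l1 x = t] = m2 [set y | code l2 y = t]].

(** A cuts every cell on the first side; [split_matching] cuts the corresponding cell on the second
    side by a set that depends on the cell, and these cuts are assembled by reading the code of the
    point. *)
Lemma matched_cons l1 l2 A : clopen_content m1 -> clopen_content m2 ->
  positive_content m1 -> splits_infinite m2 -> transfers m1 m2 ->
  matched l1 l2 -> clopen A ->
  exists2 C, clopen C & matched (A :: l1) (C :: l2).
Proof.
move=> c1 c2 pos1 spl2 tr [cl1 cl2 l12] cA.
have /choice[C Ct] t := split_matching c1 c2 pos1 spl2 tr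
  (clopen_code t cl1) (clopen_code t cl2) cA (l12 t).
pose D := [set y | C (code l2 y) y].
have cD : clopen D.
  apply/clopenP => y; have [/clopenP/(_ y)[n nC] _ _] := Ct (code l2 y).
  have /clopenP/(_ y)[k kC] := clopen_code (code l2 y) cl2.
  exists (maxn n k) => z yz.
  have := nC _ (cyl_le (leq_maxl n k) yz).
  have /kC/= := cyl_le (leq_maxr n k) yz.
  by move=> /iffRL/(_ erefl) e; rewrite /D /= e.
exists D => //; split=> //= -[|b t].
  rewrite (_ : [set x | _] = set0); last by apply/seteqP; split.
  rewrite (_ : [set x | _] = set0); last by apply/seteqP; split.
  by rewrite (content0 c1) (content0 c2).
have [cC h1 h2] := Ct t.
have e1 : [set x | code (A :: l1) x = b :: t] =
    if b then [set x | code l1 x = t] `&` A else [set x | code l1 x = t] `\` A.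
  apply/seteqP; split=> x /=.
    by case=> <- <-; case: asboolP.
  by case: b => -[/= -> Ax]; [rewrite asboolT|rewrite asboolF].
have e2 : [set x | code (D :: l2) x = b :: t] =
    if b then [set x | code l2 x = t] `&` C t else [set x | code l2 x = t] `\` C t.
  apply/seteqP; split=> x /=.
    by case=> <- <-; rewrite /D /=; case: asboolP.
  by case: b {e1} => -[/= xt Ax]; rewrite /D /= xt; [rewrite asboolT|rewrite asboolF].
by rewrite -[X in m1 X]/[set x | code (A :: l1) x = b :: t]
  -[X in m2 X]/[set x | code (D :: l2) x = b :: t] e1 e2; case: b {e1 e2}.
Qed.

End matched.

Lemma matched_sym {B1 B2} (m1 : set (bpath B1) -> \bar R)
    (m2 : set (bpath B2) -> \bar R) l1 l2 :
  matched m1 m2 l1 l2 -> matched m2 m1 l2 l1.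
Proof. by move=> [? ? h]; split. Qed.

Section code_sequence.
Context {B : stationary_diagram}.
Implicit Types (s : nat -> seq (set (bpath B))) (x y : bpath B).

(** An enumeration of the sets of paths with a prescribed edge at a prescribed index, padded with
    the whole space. *)
Definition edge_set k : set (bpath B) :=
  if unpickle k is Some je then [set x : bpath B | x je.1 = je.2 :> edge B] else setT.

Lemma clopen_edge_set k : clopen (edge_set k).
Proof. by rewrite /edge_set; case: unpickle => [je|]; [exact: clopen_edge|exact: clopenT]. Qed.

(** A stage by which all sets that prescribe edge j have been enumerated. *)
Definition edge_bound (j : nat) := \max_(e : edge B) (pickle (j, e)).+1.

(** The doubling reflects that each stage of the back-and-forth puts two sets in front. *)
Definition code_chain s := forall i j, (i <= j)%N -> s i = drop (j - i).*2 (s j).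

Lemma code_drop s i j x : code_chain s -> (i <= j)%N ->
  code (s i) x = drop (j - i).*2 (code (s j) x).
Proof. by move=> ch ij; rewrite (ch _ _ ij) /code map_drop. Qed.

Definition separating s := forall k x y,
  code (s k.+1) x = code (s k.+1) y -> edge_set k x <-> edge_set k y.

Lemma code_separates s n j x y : code_chain s -> separating s ->
  (edge_bound j <= n)%N -> code (s n) x = code (s n) y -> x j = y j.
Proof.
move=> ch sep jn xy; pose k := pickle (j, x j).
have kn : (k.+1 <= n)%N by apply: leq_trans jn; exact: (leq_bigmax (x j)).
have /sep : code (s k.+1) x = code (s k.+1) y by rewrite !(code_drop _ ch kn) xy.
by rewrite /edge_set /k pickleK => /iffLR/(_ erefl).
Qed.

Definition edges_bound K := \max_(j < K.+1) edge_bound j.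

Lemma code_separates_cyl s n K x y : code_chain s -> separating s ->
  (edges_bound K <= n)%N -> code (s n) x = code (s n) y -> cylinder K x y.
Proof.
move=> ch sep Kn xy; have e j : (j < K.+1)%N -> y j = x j.
  move=> jK; apply/esym/(code_separates ch sep _ xy); apply: leq_trans Kn.
  exact: (@leq_bigmax _ (fun j : 'I_K.+1 => edge_bound j) (Ordinal jK)).
by apply: cyl_le (cyl_prefix _ e).
Qed.

End code_sequence.

Section limit.
Context {B1 B2 : stationary_diagram}.
Variables (m1 : set (bpath B1) -> \bar R) (m2 : set (bpath B2) -> \bar R).
Variables (s1 : nat -> seq (set (bpath B1))) (s2 : nat -> seq (set (bpath B2))).
Hypotheses (c2 : clopen_content m2) (pos1 : positive_content m1).
Hypotheses (ch1 : code_chain s1) (ch2 : code_chain s2) (sep2 : separating s2).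
Hypothesis s12 : forall n, matched m1 m2 (s1 n) (s2 n).

(** The cell of x is not empty, so by positivity it is not null, and neither is the matched cell,
    which therefore contains some y n. Edge j of y n is constant from stage [edge_bound j] on, and
    the path of these eventual edges stays in every matched cell because cells are clopen. *)
Lemma code_limit x : exists y, forall n, code (s2 n) y = code (s1 n) x.
Proof.
have /choice[y yP] n : exists y, code (s2 n) y = code (s1 n) x.
  have [cl1 cl2 h] := s12 n; apply: contrapT => /forallNP ny.
  have e0 : m1 [set z | code (s1 n) z = code (s1 n) x] = 0%E.
    rewrite h (_ : [set z | _] = set0) ?content0 //.
    by apply/seteqP; split=> z // /ny.
  have : [set z | code (s1 n) z = code (s1 n) x] x by [].
  by rewrite (pos1 (clopen_code _ cl1) e0).
have yx i j : (i <= j)%N -> code (s2 i) (y j) = code (s1 i) x.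
  by move=> ij; rewrite (code_drop _ ch2 ij) yP -code_drop.
pose N j := @edge_bound B2 j.
have yN j n : (N j <= n)%N -> y n j = y (N j) j.
  move=> Nn; apply: (code_separates ch2 sep2 (leqnn (N j))).
  by rewrite !yx.
have zP j : tgt (y (N j) j) = src (y (N j.+1) j.+1).
  rewrite -(@yN j (maxn (N j) (N j.+1))) ?leq_maxl //.
  by rewrite -(@yN j.+1 (maxn (N j) (N j.+1))) ?leq_maxr // edge_atP.
pose z := @BPath B2 (fun j => y (N j) j) zP.
exists z => n.
have [_ cl2 _] := s12 n.
have /clopenP/(_ z)[K zK] := clopen_code (code (s2 n) z) cl2.
pose m := maxn n (edges_bound (B := B2) K).
have zy : cylinder K z (y m).
  have e j : (j < K.+1)%N -> y m j = z j.
    move=> jK; apply: yN; rewrite leq_max; apply/orP; right.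
    exact: (@leq_bigmax _ (fun j : 'I_K.+1 => edge_bound (B := B2) j) (Ordinal jK)).
  by apply: cyl_le (cyl_prefix _ e).
by have /zK/iffRL/(_ erefl) /= <- := zy; rewrite yx // leq_maxl.
Qed.

End limit.

Lemma cylinder_continuous {B1 B2 : stationary_diagram} (h : bpath B1 -> bpath B2) :
  (forall x n, exists k, forall y, cylinder k x y -> cylinder n (h x) (h y)) ->
  continuous h.
Proof.
move=> hP; apply/continuousP => U /openP oU; apply/openP => x /oU[n nU].
by have [k kh] := hP x n; exists k => y /kh/nU.
Qed.

Lemma code_continuous {B1 B2 : stationary_diagram} (h : bpath B1 -> bpath B2)
    (s1 : nat -> seq (set (bpath B1))) (s2 : nat -> seq (set (bpath B2))) :
  code_chain s2 -> separating s2 -> (forall n, all_clopen (s1 n)) ->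
  (forall x n, code (s2 n) (h x) = code (s1 n) x) -> continuous h.
Proof.
move=> ch2 sep2 cl1 hs; apply: cylinder_continuous => x n.
pose m := edges_bound (B := B2) n.
have /clopenP/(_ x)[k kE] := clopen_code (code (s1 m) x) (cl1 m).
exists k => y /kE/iffRL/(_ erefl) /= yx.
by apply: (code_separates_cyl ch2 sep2 (leqnn m)); rewrite !hs yx.
Qed.

(** Stage n puts [edge_set n] into each list together with a match in the other. The codes then
    separate paths on both sides, so that limits of matched cells define mutually inverse continuous
    maps. *)
Lemma back_and_forth {B1 B2 : stationary_diagram}
    (m1 : set (bpath B1) -> \bar R) (m2 : set (bpath B2) -> \bar R) :
  clopen_content m1 -> clopen_content m2 ->
  positive_content m1 -> positive_content m2 ->
  splits_infinite m1 -> splits_infinite m2 ->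
  transfers m1 m2 -> transfers m2 m1 -> m1 setT = m2 setT ->
  exists h : bpath B1 -> bpath B2, homeomorphism h /\
    forall V, clopen V -> m1 (h @^-1` V) = m2 V.
Proof.
move=> c1 c2 pos1 pos2 spl1 spl2 tr12 tr21 m12.
have /choice[f fP] (t : nat * (seq (set (bpath B1)) * seq (set (bpath B2)))) :
    exists AC : set (bpath B1) * set (bpath B2), matched m1 m2 t.2.1 t.2.2 ->
      matched m1 m2 [:: AC.1, edge_set t.1 & t.2.1] [:: edge_set t.1, AC.2 & t.2.2].
  case: t => n [l1 l2] /=.
  have [ml|] := pselect (matched m1 m2 l1 l2); last by exists (set0, set0).
  have [C _ mC] := matched_cons c1 c2 pos1 spl2 tr12 ml (clopen_edge_set n).
  have [A _ mA] := matched_cons c2 c1 pos2 spl1 tr21 (matched_sym mC) (clopen_edge_set n).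
  by exists (A, C) => _; exact: matched_sym.
pose s := fix s n := if n is n'.+1 then
    ([:: (f (n', s n')).1, edge_set n' & (s n').1],
     [:: edge_set n', (f (n', s n')).2 & (s n').2]) else ([::], [::]).
have ms n : matched m1 m2 (s n).1 (s n).2.
  elim: n => [|n IH]; last exact: (fP (n, s n)).
  split=> // -[|b t] /=.
    by rewrite (_ : [set x | _] = setT); [rewrite m12; congr (m2 _)|]; apply/seteqP.
  rewrite (_ : [set x | _] = set0); last by apply/seteqP; split.
  by rewrite (content0 c1) (_ : [set x | _] = set0) ?(content0 c2)//; apply/seteqP; split.
pose s1 n := (s n).1; pose s2 n := (s n).2.
have ch1 : code_chain s1.
  move=> i j /subnK <-; rewrite addnK.
  by elim: (j - i)%N => [|k IH]; rewrite ?drop0 // addSn doubleS.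
have ch2 : code_chain s2.
  move=> i j /subnK <-; rewrite addnK.
  by elim: (j - i)%N => [|k IH]; rewrite ?drop0 // addSn doubleS.
have sep1 : separating s1 by move=> k x y; rewrite /s1 /code /= => -[_ e _]; exact: asbool_eq_equiv.
have sep2 : separating s2 by move=> k x y; rewrite /s2 /code /= => -[e _ _]; exact: asbool_eq_equiv.
have /choice[h hP] := code_limit c2 pos1 ch1 ch2 sep2 ms.
have /choice[g gP] := code_limit c1 pos2 ch2 ch1 sep1 (fun n => matched_sym (ms n)).
have bpath_eq (B : stationary_diagram) (r : nat -> seq (set (bpath B))) x y :
    code_chain r -> separating r -> (forall n, code (r n) x = code (r n) y) -> x = y.
  by move=> ch sep e; apply: bpath_ext => j; exact: (code_separates ch sep (leqnn _) (e _)).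
have hK : cancel h g by move=> x; apply: (bpath_eq _ s1 _ _ ch1 sep1) => n; rewrite gP hP.
have gK : cancel g h by move=> x; apply: (bpath_eq _ s2 _ _ ch2 sep2) => n; rewrite hP gP.
have cl1 n : all_clopen (s1 n) by case: (ms n).
have cl2 n : all_clopen (s2 n) by case: (ms n).
have ch : continuous h by apply: (code_continuous ch2 sep2 cl1).
exists h; split.
  by split=> //; exists g; split=> //; apply: (code_continuous ch1 sep1 cl2).
move=> V cV; have [K KV] := clopen_of_level cV.
(* At this stage the cells are fine enough for V to be a union of them; summing over matched cells
   finishes the proof. *)
pose n := edges_bound (B := B2) K.
have Vn y z : code (s2 n) y = code (s2 n) z -> V y -> V z.
  by move=> /(code_separates_cyl ch2 sep2 (leqnn n))/KV[].
(* Codes of a fixed length form a finite type, as [content_sum] requires; the cast in k2 gives both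
   sides the same type. *)
pose k1 x : (size (s1 n)).-tuple bool := [tuple of [seq `[< A x >] | A <- in_tuple (s1 n)]].
have sz : size (s1 n) = size (s2 n) by rewrite /s1 /s2; elim: n {Vn k1} => //= n ->.
pose k2 y : (size (s1 n)).-tuple bool := tcast (esym sz) [tuple of [seq `[< A y >] | A <- in_tuple (s2 n)]].
have k2E y : k2 y = code (s2 n) y :> seq bool by rewrite val_tcast.
have E1 t : [set x | k1 x = t] = [set x | code (s1 n) x = t].
  by apply/seteqP; split=> x; [move=> <-|move=> xt; apply: val_inj].
have E2 t : [set x | k2 x = t] = [set x | code (s2 n) x = t].
  by apply/seteqP; split=> x; [move=> <-; rewrite k2E|move=> xt; apply: val_inj; rewrite /= k2E].
have chV : clopen (h @^-1` V) by exact: preimage_clopen.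
rewrite (@content_sum _ _ m1 c1 _ k1 _ _ chV); last by move=> t; rewrite E1; exact: clopen_code.
rewrite (@content_sum _ _ m2 c2 _ k2 _ _ cV); last by move=> t; rewrite E2; exact: clopen_code.
apply: eq_bigr => t _; rewrite E1 E2.
have [[y [Vy yt]]|none] := pselect (exists y, V y /\ code (s2 n) y = t).
  rewrite !(setIidr _); last first.
  - by move=> x /= xt; apply: (Vn y) => //; rewrite hP xt.
  - by move=> x /= xt; apply: (Vn y) => //; rewrite xt.
  by case: (ms n).
rewrite [X in m1 X](_ : _ = set0); last first.
  by apply/seteqP; split=> x // [Vx xt]; apply: none; exists (h x); rewrite hP.
rewrite [X in m2 X](_ : _ = set0); last first.
  by apply/seteqP; split=> x // [Vx xt]; apply: none; exists x.
by rewrite (content0 c1) (content0 c2).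
Qed.

End matching.

(** * Measures carried by a terminal class *)

Section borel.
Context {B : stationary_diagram}.
Implicit Types (x y z p q : bpath B).

Lemma open_measurable_bpath (U : set (borel_bpath B)) :
  open (U : set (bpath B)) -> measurable U.
Proof. exact: sub_sigma_algebra. Qed.

Lemma clopen_measurable (U : set (borel_bpath B)) :
  clopen (U : set (bpath B)) -> measurable U.
Proof. by case=> oU _; exact: open_measurable_bpath. Qed.

Lemma continuous_measurable_bpath {B' : stationary_diagram}
    (f : borel_bpath B -> borel_bpath B') :
  continuous (f : bpath B -> bpath B') -> measurable_fun setT f.
Proof.
move=> cf; apply: (@measurability _ _ (borel_bpath B) (borel_bpath B') setT f
  (@open (bpath B'))) => // _ [U oU <-].
rewrite setTI; apply: open_measurable_bpath.
by move/continuousP : cf; apply.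
Qed.

Section terminal.
Variable alpha : {set vtx B}.
Hypothesis terminal : forall e : edge B, src e \in alpha -> tgt e \in alpha.

Lemma terminal_vertex x m n : (m <= n)%N -> vertex x m \in alpha -> vertex x n \in alpha.
Proof.
move=> /subnK <-; elim: (n - m)%N => [//|k IH] /IH xa.
by rewrite addSn vertexS terminal.
Qed.

Lemma class_pathsP x : class_paths alpha x <-> exists n, vertex x n \in alpha.
Proof.
split=> [[n nP]|[n xn]]; first by exists n; exact: nP.
by exists n => k nk; exact: terminal_vertex xn.
Qed.

Lemma class_paths_open : open (class_paths alpha).
Proof.
apply/openP => x /class_pathsP[n xn]; exists n => y /cyl_vertex yx.
by apply/class_pathsP; exists n; rewrite yx.
Qed.

Lemma cylinder_class_paths n p : vertex p n \in alpha ->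
  cylinder n p `<=` class_paths alpha.
Proof. by move=> pa x /cyl_vertex xp; apply/class_pathsP; exists n; rewrite xp. Qed.

(** Uniqueness of measures from a pi-system of sets of finite measure. Comparing deep cylinders is
    enough, since every path of X_alpha lies in arbitrarily deep ones that end in alpha. *)
Lemma measure_eq_on_class {R : realType}
    (mu nu : {measure set (borel_bpath B) -> \bar R}) N :
  mu (~` class_paths alpha) = 0%E -> nu (~` class_paths alpha) = 0%E ->
  (forall n p, (N <= n)%N -> vertex p n \in alpha ->
     (mu (cylinder n p) < +oo)%E /\ mu (cylinder n p) = nu (cylinder n p)) ->
  forall A, measurable A -> mu A = nu A.
Proof.
move=> mu0 nu0 munu.
pose Z : set (borel_bpath B) := ~` class_paths alpha.
have mZ : measurable Z by apply: measurableC; apply: open_measurable_bpath; exact: class_paths_open.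
(* The cylinders that end in alpha do not cover the paths outside X_alpha, so *)
(* that the subsets of this null set are added to the pi-system.              *)
pose acyl : set (set (borel_bpath B)) := [set U | exists n p,
  [/\ (N < n)%N, vertex p n \in alpha & U = cylinder n p]].
pose G : set (set (borel_bpath B)) :=
  [set U | [\/ U = set0, acyl U | measurable U /\ U `<=` Z]].
have mG U : G U -> measurable U.
  case=> [->|[n [p [_ _ ->]]]|[]//]; first exact: measurable0.
  apply: clopen_measurable; exact: clopen_cylinder.
(* Words of edges make the family countable. As N < size s, the word is not empty and so determines
   the first vertex too. *)
pose c (s : seq (edge B)) : set (borel_bpath B) := if (N < size s)%N then
  [set x : bpath B | mkseq x (size s) = s /\ vertex x (size s) \in alpha] else set0.
have cG s : G (c s).
  rewrite /c; case: ifPn => [Ns|_]; last by constructor 1.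
  have [[p [ps pa]]|none] :=
    pselect (exists x : bpath B, mkseq x (size s) = s /\ vertex x (size s) \in alpha).
    constructor 2; exists (size s), p; split=> //.
    have nthE (x : bpath B) k : (k < size s)%N -> nth (p 0%N) (mkseq x (size s)) k = x k.
      by move=> ks; rewrite nth_mkseq.
    apply/seteqP; split=> x.
      move=> [xs _]; apply: cyl_prefix; first exact: leq_ltn_trans Ns.
      by move=> k ks; rewrite -(nthE x k ks) -(nthE p k ks) xs ps.
    move=> px; split; last by rewrite (cyl_vertex px).
    rewrite -[RHS]ps; apply: (@eq_from_nth _ (p 0%N)); rewrite !size_mkseq // => k ks.
    by rewrite (nthE x k ks) (nthE p k ks); case: px => _ ->.
  constructor 1; apply/seteqP; split=> x // [xs xa]; apply: none; by exists x.
have acyl_c n p : (N < n)%N -> vertex p n \in alpha -> c (mkseq p n) = cylinder n p.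
  move=> Nn pa; have := cG (mkseq p n).
  have pc : c (mkseq p n) p by rewrite /c size_mkseq Nn.
  case=> [c0|[m [q [Nm qa cq]]]|[_ cZ]].
  - by move: pc; rewrite c0.
  - rewrite /c size_mkseq Nn; apply/seteqP; split=> x.
      move=> [xp xa]; apply: cyl_prefix; first exact: leq_ltn_trans Nn.
      move=> k kn; have := congr1 (fun s => nth (p 0%N) s k) xp.
      by rewrite !nth_mkseq.
    move=> px; split; last by rewrite (cyl_vertex px).
    apply: (@eq_from_nth _ (p 0%N)); rewrite !size_mkseq // => k kn.
    by rewrite !nth_mkseq //; case: px => _ ->.
  - by have /(cZ _) := pc; case; apply: (cylinder_class_paths pa).
(* The countable cover by sets of finite measure, with the null set Z in front. *)
pose g k : set (borel_bpath B) := if k is k'.+1 then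
  if unpickle k' is Some s then c s else set0 else Z.
have Gg k : G (g k).
  case: k => [|k]; rewrite /g; first by constructor 3; split.
  by case: unpickle => [s|]; [exact: cG|constructor 1].
have class_cover x : class_paths alpha x -> forall n, exists k, [/\ (N < k)%N, (n <= k)%N & vertex x k \in alpha].
  move=> [m mP] n; exists (maxn m (maxn N.+1 n)); rewrite mP ?leq_maxl //.
  by split=> //; rewrite !leq_max leqnn ?orbT.
apply: (@measure_unique _ R (borel_bpath B) G g).
- apply/seteqP; split.
    apply: smallest_sub; first exact: smallest_sigma_algebra.
    move=> U oU.
    (* An open set is its part in Z together with the countably many listed cylinders that it
       contains. *)
    have -> : U = (U `&` Z) `|` \bigcup_k (if `[< g k.+1 `<=` U >] then g k.+1 else set0).
      apply/seteqP; split=> x.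
        move=> Ux; have [xa|] := pselect (class_paths alpha x); last by left.
        right; move/openP : oU => /(_ _ Ux)[n nU].
        have [k [Nk nk xk]] := class_cover _ xa n.
        exists (pickle (mkseq x k)) => //; rewrite /g pickleK acyl_c //.
        rewrite asboolT //; apply: subset_trans nU; exact: cyl_le.
      by case=> [[]//|[k _]]; case: asboolP => // gU /gU.
    apply: (@measurableU _ (g_sigma_algebraType G)).
      apply: sub_sigma_algebra; constructor 3; split; last exact: subIsetr.
      by apply: measurableI => //; exact: open_measurable_bpath.
    apply: (@bigcupT_measurable _ (g_sigma_algebraType G)) => k.
    case: ifP => _; last exact: (@measurable0 _ (g_sigma_algebraType G)).
    exact: sub_sigma_algebra.
  apply: smallest_sub => //; exact: sigma_algebra_measurable.
- move=> U V [->|[n [p [Nn pa ->]]]|[mU UZ]] HV; first by rewrite set0I; constructor 1.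
    case: HV => [->|[m [q [Nm qa ->]]]|[mV VZ]].
    + by rewrite setI0; constructor 1.
    + have [[x [px qx]]|none] := pselect (exists x, cylinder n p x /\ cylinder m q x).
        rewrite (cyl_eq px) (cyl_eq qx); constructor 2.
        have xn := cyl_vertex px; have xm := cyl_vertex qx.
        have [nm|/ltnW mn] := leqP n m.
          exists m, x; rewrite xm; split=> //; apply/setIidPr; exact: cyl_le.
        exists n, x; rewrite xn; split=> //; apply/setIidPl; exact: cyl_le.
      constructor 1; apply/seteqP; split=> x // [px qx]; apply: none; by exists x.
    + constructor 1; apply/seteqP; split=> x // [px Vx].
      by apply: (VZ _ Vx); exact: (cylinder_class_paths pa).
  by constructor 3; split; [apply: measurableI => //; exact: mG|move=> x [/UZ]].
- exact: Gg.
- apply/seteqP; split=> x // _; have [xa|xa] := pselect (class_paths alpha x); last by exists 0%N.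
  have [k [Nk _ xk]] := class_cover _ xa 0%N.
  by exists (pickle (mkseq x k)).+1 => //; rewrite /g pickleK acyl_c.
- move=> U [->|[n [p [Nn pa ->]]]|[mU UZ]]; first by rewrite !measure0.
    by case: (munu n p (ltnW Nn) pa).
  have null (ka : {measure set (borel_bpath B) -> \bar R}) : ka Z = 0%E -> ka U = 0%E.
    move=> kZ; apply/eqP; rewrite eq_le measure_ge0 andbT -kZ.
    by apply: le_measure => //; rewrite inE.
  by rewrite !null.
- move=> k; case: (Gg k) => [->|[n [p [Nn pa ->]]]|[mU UZ]]; first by rewrite measure0.
    by case: (munu n p (ltnW Nn) pa).
  apply: (@le_lt_trans _ _ (mu Z)); last by rewrite mu0.
  by apply: le_measure => //; rewrite inE.
Qed.

End terminal.
End borel.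

Section image_measure.
Context d d' (T1 : measurableType d) (T2 : measurableType d') (R : realFieldType).
Variables (m : {measure set T1 -> \bar R}) (f : T1 -> T2).
Hypothesis mf : measurable_fun setT f.

(* The proof of measurability is an argument so that the structure of measure *)
(* can be inferred.                                                           *)
Definition image_measure of measurable_fun setT f := pushforward m f.

Let image_measureE A : image_measure mf A = m (f @^-1` A). Proof. by []. Qed.

Let image_measure0 : image_measure mf set0 = 0%E.
Proof. by rewrite image_measureE preimage_set0 measure0. Qed.

Let image_measure_ge0 A : (0 <= image_measure mf A)%E.
Proof. by rewrite image_measureE; apply: measure_ge0; rewrite -[X in measurable X]setTI; exact: mf. Qed.

Let image_measure_additive : semi_sigma_additive (image_measure mf).
Proof.
move=> F mF tF mUF; rewrite /image_measure /pushforward preimage_bigcup.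
apply: measure_semi_sigma_additive.
- by move=> n; rewrite -[X in measurable X]setTI; exact: mf.
- apply/trivIsetP => /= i j _ _ ij; rewrite -preimage_setI.
  by move/trivIsetP : tF => /(_ _ _ _ _ ij) ->//; rewrite preimage_set0.
- by rewrite -preimage_bigcup -[X in measurable X]setTI; exact: mf.
Qed.

HB.instance Definition _ := isMeasure.Build _ _ _ (image_measure mf)
  image_measure0 image_measure_ge0 image_measure_additive.

End image_measure.

Section eigen_measure.
Context {R : realType} {B : stationary_diagram}.
Variables (alpha : {set vtx B}) (lam : R) (xi : vtx B -> R).
Variable mu : {measure set (borel_bpath B) -> \bar R}.
Hypothesis terminal : forall e : edge B, src e \in alpha -> tgt e \in alpha.
Hypothesis lam_gt0 : 0 < lam.
Hypothesis mu_null : mu (~` class_paths alpha) = 0%E.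
Hypothesis mu_cyl : forall n p, vertex p n \in alpha ->
  mu (cylinder n p) = (xi (vertex p n) / lam ^+ n)%:E.

Section move_segment.
Variables (n m : nat) (p q : bpath B).
Hypothesis pq : vertex p n = vertex q m.

(** The identity off the cylinder of p makes the map total and continuous, so that image measures
    along it exist. *)
Definition move_segment (x : bpath B) : bpath B :=
  if `[< cylinder n p x >] then
    get [set z : bpath B | cylinder m q z /\ forall k, z (m + k)%N = x (n + k)%N]
  else x.

Lemma move_segmentP x : cylinder n p x ->
  cylinder m q (move_segment x) /\ forall k, move_segment x (m + k)%N = x (n + k)%N.
Proof.
move=> px; rewrite /move_segment asboolT //.
apply: (@getPex _ [set z : bpath B | cylinder m q z /\ forall k, z (m + k)%N = x (n + k)%N]).
by apply: splice; rewrite (cyl_vertex px).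
Qed.

Lemma cylinder_move x y j : cylinder n p x -> cylinder n p y ->
  cylinder (n + j) x y -> cylinder (m + j) (move_segment x) (move_segment y).
Proof.
move=> px py xy; have [qx xE] := move_segmentP px; have [qy yE] := move_segmentP py.
have qxy := cyl_trans (cyl_sym qx) qy; split; first by case: qxy.
move=> k kj; have [km|mk] := ltnP k m; first by case: qxy => _ ->.
rewrite -(subnKC mk) xE yE; case: xy => _ -> //.
by rewrite ltn_add2l -(ltn_add2l m) subnKC.
Qed.

Lemma move_segment_continuous : continuous move_segment.
Proof.
apply: cylinder_continuous => x j; have [px|npx] := pselect (cylinder n p x).
  exists (n + j)%N => y xy.
  have py : cylinder n p y by apply: cyl_trans px (cyl_le _ xy); exact: leq_addr.
  by apply: cyl_le (cylinder_move px py xy); exact: leq_addl.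
exists (maxn n j) => y xy; rewrite /move_segment !asboolF //.
  by apply: cyl_le xy; exact: leq_maxr.
by move=> py; apply: npx; apply: cyl_trans py (cyl_sym _); apply: cyl_le xy; exact: leq_maxl.
Qed.

Lemma cylinder_move_preimage k r : cylinder m q r ->
  exists2 z, vertex z (n + k)%N = vertex r (m + k)%N &
    cylinder n p `&` move_segment @^-1` cylinder (m + k) r = cylinder (n + k) z.
Proof.
move=> qr; have [|z [pz zE]] := @splice B n p m r; first by rewrite (cyl_vertex qr).
exists z; first by rewrite /vertex zE.
have [qz mE] := move_segmentP pz.
have mz : move_segment z = r.
  apply: bpath_ext => j; have [jm|mj] := ltnP j m.
    by case: qz => _ -> //; case: qr => _ -> //.
  by rewrite -(subnKC mj) mE zE.
apply/seteqP; split=> x.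
  move=> [px rx]; have [qx xE] := move_segmentP px.
  have zx := cyl_trans (cyl_sym pz) px; split; first by case: zx.
  move=> j jk; have [jn|nj] := ltnP j n; first by case: zx => _ ->.
  rewrite -(subnKC nj) zE -xE; case: rx => _ -> //.
  by rewrite ltn_add2l -(ltn_add2l n) subnKC.
move=> zx; have px := cyl_trans pz (cyl_le (leq_addr _ _) zx).
by split=> //; rewrite /preimage /= -mz; exact: cylinder_move.
Qed.

(** Both sides, extended to all E by intersecting with the cylinder of q, are measures carried by
    X_alpha. On a cylinder of level m + j inside that of q which ends in a, both equal xi_a / lam ^
    j, and [measure_eq_on_class] applies. *)
Lemma measure_move (E : set (borel_bpath B)) : measurable E -> E `<=` cylinder m q ->
  ((lam ^+ n)%:E * mu (cylinder n p `&` move_segment @^-1` E) = (lam ^+ m)%:E * mu E)%E.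
Proof.
move=> mE Eq.
have mc j r : measurable (cylinder j r : set (borel_bpath B)).
  by apply: clopen_measurable; exact: clopen_cylinder.
have lamn j : 0 <= lam ^+ j by rewrite exprn_ge0 // ltW.
have mms : measurable_fun setT (move_segment : borel_bpath B -> borel_bpath B).
  apply: continuous_measurable_bpath; exact: move_segment_continuous.
pose k1 := mscale (NngNum (lamn n)) (image_measure (mrestr mu (mc n p)) mms).
pose k2 := mscale (NngNum (lamn m)) (mrestr mu (mc m q)).
have k1E A : k1 A = ((lam ^+ n)%:E * mu (cylinder n p `&` move_segment @^-1` A))%E.
  by rewrite setIC.
have k2E A : k2 A = ((lam ^+ m)%:E * mu (cylinder m q `&` A))%E by rewrite setIC.
rewrite -k1E -[in RHS](setIidr Eq) -k2E.
have null (A : set (borel_bpath B)) : A `<=` ~` class_paths alpha -> measurable A -> mu A = 0%E.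
  move=> AZ mA; apply/eqP; rewrite eq_le measure_ge0 andbT -mu_null.
  apply: le_measure => //; rewrite inE //; apply: measurableC.
  by apply: open_measurable_bpath; exact: class_paths_open.
have mZ : measurable (~` class_paths alpha : set (borel_bpath B)).
  by apply: measurableC; apply: open_measurable_bpath; exact: class_paths_open.
apply: (measure_eq_on_class terminal (N := m)) => //.
- apply: (eq_trans (k1E _)); rewrite null ?mule0 //; last first.
    by apply: measurableI => //; rewrite -[X in measurable X]setTI; exact: (mms measurableT).
  move=> x [px nx] /(class_pathsP terminal)[j xj]; apply: nx.
  have [_ xE] := move_segmentP px.
  apply/(class_pathsP terminal); exists (m + j)%N.
  rewrite /vertex xE -/(vertex x _).
  by apply: (terminal_vertex terminal) xj; exact: leq_addl.
- apply: (eq_trans (k2E _)); rewrite (null (cylinder m q `&` _)) ?mule0 //; exact: measurableI.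
- move=> j r /subnKC <-; move: (j - m)%N => {}j ra.
  suff : (k1 (cylinder (m + j) r) < +oo)%E /\ k1 (cylinder (m + j) r) = k2 (cylinder (m + j) r) by [].
  rewrite k1E k2E; have [[x [qx rx]]|none] :=
      pselect (exists x, cylinder m q x /\ cylinder (m + j) r x).
    rewrite -(cyl_vertex rx) in ra.
    rewrite (cyl_eq rx) [cylinder m q `&` _]setIidr; last first.
      by rewrite (cyl_eq qx); apply: cyl_le; exact: leq_addr.
    have [z zv ->] := cylinder_move_preimage j qx.
    rewrite (mu_cyl ra) mu_cyl ?zv // -!EFinM; split; first exact: ltry.
    congr (_%:E); rewrite mulrCA [RHS]mulrCA; congr (_ * _).
    by rewrite !exprD !invfM !mulrA !divff ?mul1r // expf_neq0 // gt_eqF.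
  rewrite (_ : cylinder n p `&` _ = set0); last first.
    apply/seteqP; split=> x // [px rx]; apply: none; exists (move_segment x).
    by split=> //; case: (move_segmentP px).
  rewrite (_ : cylinder m q `&` _ = set0); last first.
    by apply/seteqP; split=> x // [qx rx]; apply: none; exists x.
  by rewrite measure0 !mule0; split=> //; exact: ltry.
Qed.

End move_segment.

(** The common end vertex may lie outside alpha; this is the scaling behind the geometric series in
    [eigen_measure_splits_infinite]. *)
Lemma measure_cylinder_shift n p (v : bpath B) : vertex p n = vertex v 0 ->
  ((lam ^+ n)%:E * mu (cylinder n p) = mu (cylinder 0 v))%E.
Proof.
move=> pv; have := @measure_move n 0 p v pv (cylinder 0 v).
rewrite expr0 mul1e => <- //.
  congr (_ * mu _)%E; apply/seteqP; split=> x; last by case.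
  by move=> px; split=> //; case: (move_segmentP pv px).
by apply: clopen_measurable; exact: clopen_cylinder.
Qed.

Lemma eigen_measure_invariant : invariant_measure mu.
Proof.
move=> n p q A pq mA Ap.
have qp := esym pq.
have -> : replace_segment n q A = cylinder n q `&` move_segment n n q p @^-1` A.
  apply/seteqP; split=> y.
    move=> [qy [x Ax xy]]; split=> //; have [py yE] := move_segmentP qp qy.
    suff : move_segment n n q p y = x by rewrite /preimage /= => ->.
    apply: bpath_ext => j; have [jn|nj] := ltnP j n.
      by case: py => _ -> //; case: (Ap _ Ax) => _ ->.
    by rewrite -(subnKC nj) yE xy // leq_addr.
  move=> [qy Ay]; split=> //; exists (move_segment n n q p y) => //.
  move=> j nj; have [_ yE] := move_segmentP qp qy.
  by rewrite -(subnKC nj) yE.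
have := measure_move qp mA Ap.
have cancel a : (((lam ^+ n)^-1)%:E * ((lam ^+ n)%:E * a) = a)%E.
  by rewrite muleA -EFinM mulVf ?mul1e // expf_neq0 // gt_eqF.
by move/(congr1 (mule ((lam ^+ n)^-1)%:E)); rewrite !cancel.
Qed.

End eigen_measure.

(** * Perron-Frobenius rigidity and ergodicity *)

Section perron_frobenius.
Context {R : realType}.

Lemma exists_pos_lower_bound (T : finType) (f : T -> R) :
  (forall t, 0 < f t) -> exists2 d, 0 < d & forall t, d <= f t.
Proof.
move=> f0; case: (pickP (@predT T)) => [t0 _|none]; last first.
  by exists 1 => // t; have := none t.
by case: (@Order.TotalTheory.arg_minP _ _ _ t0 predT f isT) => t _ ft;
  exists (f t) => // u; exact: ft.
Qed.

Lemma le0_expr_le (a b : R) : 0 <= b < 1 -> (forall N, a <= b ^+ N) -> a <= 0.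
Proof.
move=> /andP[b0 b1] ab; have cb : b ^+ N @[N --> \oo] --> (0 : R).
  by apply: cvg_expr; rewrite ger0_norm.
by apply: (cvgr_to_ge cb); apply: nearW.
Qed.

(* Coupling two rows of M gives the contraction: the diagonal terms of the    *)
(* double sum vanish and carry a mass at least d.                             *)
Lemma stochastic_contraction k (M : 'M[R]_k) (d D : R) (r : 'I_k -> R) :
  0 <= D -> (forall i j, 0 <= M i j) -> (forall i j, d <= M i j) ->
  (forall i, \sum_j M i j = 1) -> (forall j l, r j - r l <= D) ->
  forall i i', \sum_j M i j * r j - \sum_j M i' j * r j <= (1 - d) * D.
Proof.
move=> D0 M0 Md M1 rD i i'.
have E (u v : 'I_k -> R) : (\sum_j M i j * u j) * 1 = \sum_j \sum_l M i j * M i' l * u j.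
  rewrite mulr1; apply: eq_bigr => j _; rewrite -mulr_suml -mulr_sumr M1 mulr1.
  by [].
have -> : \sum_j M i j * r j - \sum_j M i' j * r j =
    \sum_j \sum_l M i j * M i' l * (r j - r l).
  transitivity (\sum_j \sum_l (M i j * M i' l * r j) - \sum_j \sum_l (M i j * M i' l * r l)).
    congr (_ - _); first by rewrite -E // mulr1.
    rewrite exchange_big; apply: eq_bigr => l _ /=; rewrite -mulr_suml -mulr_suml M1.
    by rewrite mul1r.
  rewrite -sumrB; apply: eq_bigr => j _; rewrite -sumrB; apply: eq_bigr => l _.
  by rewrite mulrBr.
apply: (@le_trans _ _ (\sum_j \sum_l (M i j * M i' l * D - (if j == l then M i j * M i' l * D else 0)))).
  apply: ler_sum => j _; apply: ler_sum => l _; case: eqP => [->|_].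
    by rewrite !subrr mulr0.
  by rewrite subr0 ler_wpM2l // mulr_ge0.
under eq_bigr do rewrite sumrB -big_mkcond.
rewrite sumrB mulrBl lerB //.
  under eq_bigr do rewrite -mulr_suml -mulr_sumr M1 mulr1.
  by rewrite -mulr_suml M1.
rewrite -[d]mulr1 -(M1 i) mulr_sumr mulr_suml; apply: ler_sum => j _.
rewrite (eq_bigl (pred1 j)) => [|l]; last by rewrite /= eq_sym.
by rewrite big_pred1_eq [d * _]mulrC ler_wpM2r // ler_wpM2l.
Qed.

(** The ratios r n i = x n i * lam ^ n / xi i lie in [0, 1]. Conjugating A ^ m by the diagonal of xi
    and dividing by lam ^ m gives a stochastic matrix M with entries at least d > 0 and r n = M r (n
    + m). Iterating the contraction bounds the oscillation of r n by (1 - d) ^ N for all N, so r n i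
    does not depend on i; the eigenvector equation then removes the dependence on n. *)
Lemma eigen_sequence_unique k (A : 'M[R]_k) m (lam : R) (xi : 'cV[R]_k)
    (x : nat -> 'cV[R]_k) :
  (forall i j, 0 < (A ^+ m) i j) -> 0 < lam -> (forall i, 0 < xi i 0) ->
  A *m xi = lam *: xi -> (forall n, x n = A *m x n.+1) ->
  (forall n i, 0 <= x n i 0 <= xi i 0 / lam ^+ n) ->
  exists c, 0 <= c /\ forall n i, x n i 0 = c * (xi i 0 / lam ^+ n).
Proof.
move=> Am l0 xi0 Axi xA x01.
have ln n : lam ^+ n != 0 by rewrite expf_neq0 // gt_eqF.
have xine i : xi i 0 != 0 by rewrite gt_eqF.
have Anxi n : A ^+ n *m xi = lam ^+ n *: xi.
  elim: n => [|n IH]; first by rewrite !expr0 scale1r mul1mx.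
  by rewrite exprS -mulmxE -mulmxA IH -scalemxAr Axi scalerA exprSr.
have xAn n j : x n = A ^+ j *m x (n + j)%N.
  elim: j => [|j IH]; first by rewrite expr0 mul1mx addn0.
  by rewrite IH {1}xA addnS exprSr -mulmxE mulmxA.
pose r n i := x n i 0 * lam ^+ n / xi i 0.
pose M : 'M[R]_k := \matrix_(i, j) ((A ^+ m) i j * xi j 0 / (lam ^+ m * xi i 0)).
have M0 i j : 0 < M i j by rewrite mxE !(mulr_gt0, invr_gt0, exprn_gt0).
have M1 i : \sum_j M i j = 1.
  under eq_bigr do rewrite mxE.
  rewrite -mulr_suml; have := congr1 (fun v : 'cV[R]_k => v i 0) (Anxi m).
  by rewrite !mxE => ->; rewrite divff // mulf_neq0.
have rM n i : r n i = \sum_j M i j * r (n + m)%N j.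
  rewrite /r {1}(xAn n m) mxE !mulr_suml; apply: eq_bigr => j _.
  rewrite mxE exprD; have := (ln n); have := (ln m); have := xine i; have := xine j.
  move: (lam ^+ n) (lam ^+ m) (xi i 0) (xi j 0) => a b c d d0 c0 b0 a0.
  by field; rewrite d0 c0 b0.
have [d d0 dM] := @exists_pos_lower_bound ('I_k * 'I_k)%type (fun ij => M ij.1 ij.2) (fun ij => M0 _ _).
have rE n i j : r n i <= r n j.
  have d1 : d <= 1.
    rewrite -(M1 i) (bigD1 i) //= (le_trans (dM (i, i))) // lerDl.
    by apply: sumr_ge0 => l _; exact: ltW.
  rewrite -subr_le0; apply: (@le0_expr_le _ (1 - d)); first by rewrite subr_ge0 d1 ltrBlDr ltrDl.
  move=> N; elim: N n i j => [|N IH] n i j.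
    have /andP[xi1 xi2] := x01 n i; have /andP[xj1 xj2] := x01 n j.
    rewrite expr0 lerBlDr; apply: (@le_trans _ _ 1).
      by rewrite /r ler_pdivrMr // mul1r -ler_pdivlMr ?exprn_gt0.
    by rewrite lerDl /r !mulr_ge0 ?invr_ge0 ?exprn_ge0 // ltW.
  rewrite (rM n i) (rM n j) exprS; apply: stochastic_contraction => //.
  - by rewrite exprn_ge0 // subr_ge0.
  - by move=> ? ?; exact: ltW.
  - by move=> i' j'; exact: (dM (i', j')).
have [i0 _|none] := pickP (@predT 'I_k); last first.
  by exists 0; split=> // n i; have := none i.
have xr n i : x n i 0 = r n i0 * (xi i 0 / lam ^+ n).
  have -> : r n i0 = r n i by apply/le_anti; rewrite !rE.
  by rewrite /r; field; rewrite ln xine.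
have rS n : r n i0 = r n.+1 i0.
  have := congr1 (fun v : 'cV[R]_k => v i0 0) (xA n).
  rewrite mxE (eq_bigr (fun j => A i0 j * xi j 0 * (r n.+1 i0 / lam ^+ n.+1))); last first.
    by move=> j _; rewrite xr; move: (lam ^+ n.+1) (ln n.+1) => a a0; field.
  rewrite -mulr_suml xr; have := congr1 (fun v : 'cV[R]_k => v i0 0) Axi.
  rewrite !mxE => -> e; apply: (@mulIf _ (xi i0 0 / lam ^+ n)).
    by rewrite mulf_neq0 // invr_neq0.
  rewrite e exprS; move: (lam ^+ n) (ln n) (negbT (gt_eqF l0)) => a a0 lam0.
  by field; rewrite a0.
exists (r 0%N i0); split.
  by have /andP[? _] := x01 0%N i0; rewrite /r !mulr_ge0 ?invr_ge0 ?exprn_ge0 // ltW.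
by move=> n i; rewrite xr; congr (_ * _); elim: n => // n <-.
Qed.

End perron_frobenius.

Section class_measures.
Context {B : stationary_diagram}.

Lemma sum_edges (V : nmodType) (f : vtx B -> V) v :
  \sum_(e : edge B | src e == v) f (tgt e) = \sum_w f w *+ inc B w v.
Proof.
transitivity (\sum_(ji : vtx B * vtx B | ji.1 == v) \sum_(k < inc B ji.2 ji.1) f ji.2).
  by rewrite sig_big_dep; apply: eq_bigl => e; rewrite andbT.
transitivity (\sum_(j | j == v) \sum_w f w *+ inc B w j); last by rewrite big_pred1_eq.
rewrite pair_big_dep; apply: eq_big => [[j w]|[j w] _] /=; first by rewrite andbT.
by rewrite sumr_const card_ord.
Qed.

Variable alpha : {set vtx B}.
Hypothesis terminal : forall e : edge B, src e \in alpha -> tgt e \in alpha.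

Lemma terminal_inc v w : v \in alpha -> w \notin alpha -> inc B w v = 0%N.
Proof.
move=> va; apply: contraNeq; rewrite -lt0n => F0.
exact: (@terminal (existT (fun ji : vtx B * vtx B => 'I_(inc B ji.2 ji.1))
  (v, w) (Ordinal F0))).
Qed.

Lemma sum_edges_class (V : nmodType) (f : vtx B -> V) (i : 'I_#|alpha|) :
  \sum_(e : edge B | src e == enum_val i) f (tgt e) =
  \sum_(j < #|alpha|) f (enum_val j) *+ class_block alpha i j.
Proof.
rewrite sum_edges (bigID (mem alpha)) /= [X in _ + X]big1 ?addr0.
  by rewrite big_enum_val; apply: eq_bigr => j _; rewrite !mxE.
by move=> w wa; rewrite terminal_inc // enum_valP.
Qed.

Context {R : realType}.
Variable mu : {measure set (borel_bpath B) -> \bar R}.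

(** [class_measure] with the eigenvector indexed by vertices and its equation written over outgoing
    edges; the values of xi off alpha are arbitrary. *)
Definition eigen_measure (lam : R) (xi : vtx B -> R) := [/\ 1 < lam,
  forall v, v \in alpha -> 0 < xi v,
  forall v, v \in alpha -> \sum_(e : edge B | src e == v) xi (tgt e) = lam * xi v,
  mu (~` class_paths alpha) = 0%E &
  forall n p, vertex p n \in alpha ->
    mu (cylinder n p) = (xi (vertex p n) / lam ^+ n)%:E].

Lemma class_measureE : class_measure mu alpha <->
  exists (lam : R) (xi : vtx B -> R), eigen_measure lam xi.
Proof.
split=> [[lam [xi [l1 xi0 Axi null cyl]]]|[lam [xi [l1 xi0 Axi null cyl]]]].
  pose xv w := \sum_(k | enum_val k == w) xi k 0; exists lam, xv.
  have xE k : xv (enum_val k) = xi k 0.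
    by apply: big_pred1 => k' /=; rewrite (inj_eq enum_val_inj).
  have va v : v \in alpha -> exists k : 'I_#|alpha|, v = enum_val k.
    by move=> va; exists (enum_rank_in va v); rewrite enum_rankK_in.
  split=> //.
  - by move=> v /va[k ->]; rewrite xE.
  - move=> v /va[k ->]; rewrite (sum_edges_class xv) xE.
    have := congr1 (fun v : 'cV[R]_#|alpha| => v k 0) Axi.
    rewrite !mxE => <-; apply: eq_bigr => j _; rewrite xE [in RHS]mxE.
    by rewrite mulr_natl.
  - by move=> n p /va[k pk]; rewrite pk xE; exact: cyl.
exists lam, (\col_k xi (enum_val k)); split=> //.
- by move=> k; rewrite mxE xi0 // enum_valP.
- apply/matrixP => i j; rewrite {j}ord1 !mxE -Axi ?enum_valP // (sum_edges_class xi).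
  by apply: eq_bigr => j _; rewrite mxE [X in _ * X]mxE mulr_natl.
- by move=> n p k pk; rewrite cyl pk ?enum_valP // mxE.
Qed.

Lemma eigen_measure_ergodic lam xi : primitive_mx (class_block alpha) ->
  eigen_measure lam xi -> ergodic_measure mu.
Proof.
move=> [m m0 prim] [l1 xi0 Axi null cyl] A mA invA.
have l0 : 0 < lam by exact: lt_trans l1.
have mc j r : measurable (cylinder j r : set (borel_bpath B)).
  by apply: clopen_measurable; exact: clopen_cylinder.
have inv := eigen_measure_invariant terminal l0 null cyl.
have cA n p q : vertex p n = vertex q n -> mu (A `&` cylinder n p) = mu (A `&` cylinder n q).
  move=> pq; rewrite -(inv n p q (A `&` cylinder n p)) //; last exact: measurableI.
  congr (mu _); apply/seteqP; split=> y.
    move=> [qy [x [Ax px] yx]]; split=> //; apply: invA Ax.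
    by exists n => k nk; rewrite yx.
  move=> [Ay qy]; split=> //.
  have [|x [px xy]] := @splice B n p n y; first by rewrite pq (cyl_vertex qy).
  have xyE k : (n <= k)%N -> y k = x k by move=> nk; rewrite -(subnKC nk) xy.
  by exists x => //; split=> //; apply: invA Ay; exists n.
pose P n (i : 'I_#|alpha|) : bpath B := get [set x : bpath B | vertex x n = enum_val i].
have PE n i : vertex (P n i) n = enum_val i by exact: (getPex (exists_path_to n (enum_val i))).
pose x n : 'cV[R]_#|alpha| := \col_i fine (mu (A `&` cylinder n (P n i))).
have bound n p : vertex p n \in alpha ->
    (mu (A `&` cylinder n p) <= (xi (vertex p n) / lam ^+ n)%:E)%E.
  move=> pa; rewrite -cyl //; apply: le_measure; rewrite ?inE //.
  exact: measurableI.
have fin n p : vertex p n \in alpha -> mu (A `&` cylinder n p) \is a fin_num.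
  move=> pa; rewrite ge0_fin_numE ?measure_ge0 //.
  by apply: le_lt_trans (bound _ _ pa) (ltry _).
have xE n p (i : 'I_#|alpha|) : vertex p n = enum_val i ->
    mu (A `&` cylinder n p) = (x n i 0)%:E.
  move=> pi; rewrite mxE fineK; first by apply: cA; rewrite PE.
  by rewrite fin // PE enum_valP.
pose M : 'M[R]_#|alpha| := map_mx (fun k : nat => k%:R) (class_block alpha).
have ME i j : M i j = (class_block alpha i j)%:R by rewrite mxE.
have [|||||c [c0 xc]] := @eigen_sequence_unique R _ M m lam (\col_i xi (enum_val i)) x _ l0.
- move=> i j.
  have -> : (M ^+ m) = map_mx (fun k : nat => k%:R) (class_block alpha ^+ m).
    elim: (m) => [|k IH].
      by apply/matrixP => ? ?; rewrite !expr0 !mxE; case: eqP.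
    rewrite !exprS IH -!mulmxE; apply/matrixP => ? ?; rewrite !mxE natr_sum.
    by apply: eq_bigr => l _; rewrite !mxE natrM.
  by rewrite mxE ltr0n.
- by move=> i; rewrite mxE xi0 // enum_valP.
- apply/matrixP => i j; rewrite {j}ord1 !mxE -Axi ?enum_valP // (sum_edges_class xi).
  by apply: eq_bigr => j _; rewrite ME [X in _ * X]mxE mulr_natl.
- move=> n; apply/matrixP => i j; rewrite {j}ord1; apply: EFin_inj.
  rewrite -(xE n (P n i)) // [in RHS]mxE.
  transitivity (\sum_(e : edge B | src e == enum_val i)
      (\sum_(k | enum_val k == tgt e) x n.+1 k 0)%:E)%E; last first.
    rewrite sumEFin (sum_edges_class (fun w => \sum_(k | enum_val k == w) x n.+1 k 0)).
    congr (_%:E); apply: eq_bigr => j _; rewrite ME mulr_natl; congr (_ *+ _).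
    by apply: big_pred1 => k' /=; rewrite (inj_eq enum_val_inj).
  pose nu U := mu (A `&` (U : set (borel_bpath B))).
  have cnu : clopen_content nu.
    split; first by rewrite /nu setI0 measure0.
      by move=> U cU; apply: measure_ge0; apply: measurableI => //; exact: clopen_measurable.
    move=> U V /clopen_measurable mU /clopen_measurable mV UV.
    rewrite /nu setIUr measureU //; [exact: measurableI|exact: measurableI|].
    by rewrite setIACA UV setI0.
  rewrite -/(nu _) (content_sum_edge cnu (clopen_cylinder n (P n i)) (@subset_refl _ _)).
  rewrite PE; apply: eq_bigr => e /eqP ei.
  have [|z [Pz ze]] := @graft B n (P n i) e; first by rewrite PE.
  rewrite -ze cylinder_edge // ze.
  have ta : tgt e \in alpha by apply: terminal; rewrite ei enum_valP.
  have tk : tgt e = enum_val (enum_rank_in ta (tgt e)) by rewrite enum_rankK_in.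
  rewrite /nu (xE n.+1 z (enum_rank_in ta (tgt e))); last by rewrite vertexS ze.
  congr (_%:E); apply/esym/big_pred1 => k' /=.
  by rewrite {1}tk (inj_eq enum_val_inj).
- move=> n i; have a := PE n i; have ia : vertex (P n i) n \in alpha by rewrite a enum_valP.
  rewrite -!lee_fin mxE fineK ?fin // measure_ge0 mxE -a bound //.
have cge : 0 <= c by [].
pose k2 := mscale (NngNum cge) mu.
have k12 E : measurable E -> mrestr mu mA E = k2 E.
  apply: (@measure_eq_on_class B alpha terminal R (mrestr mu mA) k2 0).
  - apply/eqP; rewrite eq_le measure_ge0 andbT -[leRHS]null.
    apply: le_measure; rewrite ?inE; last exact: subIsetl.
      apply: measurableI => //; apply: measurableC.
      by apply: open_measurable_bpath; exact: class_paths_open.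
    apply: measurableC.
    by apply: open_measurable_bpath; exact: class_paths_open.
  - by rewrite /k2 /= /mscale null mule0.
  - move=> n p _ pa; have pk : vertex p n = enum_val (enum_rank_in pa (vertex p n)).
      by rewrite enum_rankK_in.
    suff : (mu (cylinder n p `&` A) < +oo)%E /\ mu (cylinder n p `&` A) = k2 (cylinder n p) by [].
    rewrite setIC -ge0_fin_numE ?measure_ge0 // fin //; split=> //.
    by rewrite (xE _ _ _ pk) xc mxE -pk /k2 /= /mscale /= cyl.
have : mrestr mu mA (~` A) = k2 (~` A) by apply: k12; exact: measurableC.
rewrite /mrestr setICl measure0 /k2 /mscale /= => /esym/eqP.
rewrite mule_eq0 eqe => /orP[/eqP ce|/eqP]; last by right.
left; have := k12 A mA; rewrite /mrestr setIid => ->.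
by rewrite /k2 /mscale /= ce mul0e.
Qed.

End class_measures.

(** * Infinite clopen sets split *)

Section eigen_measure_values.
Context {R : realType} {B : stationary_diagram}.
Variables (alpha : {set vtx B}) (lam : R) (xi : vtx B -> R).
Variable mu : {measure set (borel_bpath B) -> \bar R}.
Hypothesis terminal : forall e : edge B, src e \in alpha -> tgt e \in alpha.
Hypothesis eig : eigen_measure alpha mu lam xi.

Lemma measure_clopen_content : clopen_content mu.
Proof.
split; first exact: measure0.
  by move=> U cU; apply: measure_ge0.
by move=> U V /clopen_measurable mU /clopen_measurable mV UV; rewrite measureU.
Qed.

Lemma full_positive_content : full_measure mu -> positive_content mu.
Proof.
move=> full U [oU _] U0; apply: contrapT => /eqP/set0P /(full _ oU).
by rewrite U0 ltxx.
Qed.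

Lemma geometric_partial_le (q : R) N : 0 <= q < 1 -> \sum_(0 <= k < N) q ^+ k <= (1 - q)^-1.
Proof.
move=> /andP[q0 q1]; have q1' : 0 < 1 - q by rewrite subr_gt0.
have -> : \sum_(0 <= k < N) q ^+ k = (1 - q ^+ N) / (1 - q).
  elim: N => [|N IH]; first by rewrite big_geq // expr0 subrr mul0r.
  by rewrite big_nat_recr //= IH exprS; field; rewrite gt_eqF.
by rewrite -[leRHS]mul1r ler_wpM2r // ?invr_ge0 ?(ltW q1') // gerBl exprn_ge0.
Qed.

(* If an infinite cylinder could not be split, exactly one of the cylinders   *)
(* below it would be infinite at each level; what branches off at level k has *)
(* measure O(lam ^- k) by scaling, and the series converges.                  *)
Lemma eigen_measure_splits_infinite : splits_infinite mu.
Proof.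
case: eig => l1 xi0 Axi null cyl U cU Uoo.
have l0 : 0 < lam by exact: lt_trans l1.
have c := measure_clopen_content.
apply: contrapT => nsplit.
(* By finite additivity an infinite clopen set contains an infinite cylinder. *)
have [[n [p [pU poo]]]|none] := pselect (exists n p, cylinder n p `<=` U /\ mu (cylinder n p) = +oo%E); last first.
  have : (mu U < +oo)%E.
    apply: (@clopen_ind B (fun V => mu (V : set (borel_bpath B)) < +oo)%E) => //.
    - by rewrite measure0.
    - move=> V W cV cW VW Voo Woo; rewrite (contentU c) //.
      by rewrite lte_add_pinfty.
    - move=> n p pU; rewrite ltey; apply/eqP => poo; apply: none; by exists n, p.
  by rewrite Uoo.
have nsplitp V : clopen V -> V `<=` cylinder n p -> mu V = +oo%E ->
    (mu (cylinder n p `\` V) < +oo)%E.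
  move=> cV Vp Voo; rewrite ltey; apply/eqP => Doo; apply: nsplit; exists V.
  split=> //; first by apply: subset_trans pU.
  apply/eqP; rewrite -leye_eq -Doo; apply: (le_content c).
  - by apply: clopenD => //; exact: clopen_cylinder.
  - exact: clopenD.
  - by apply: setSD.
have [||//|x px xoo] := @konig B (fun k y => mu (cylinder k y) = +oo%E) n p.
- by move=> k y z /cyl_eq ->.
- move=> k y yoo; apply: contrapT => none.
  suff : (mu (cylinder k y) < +oo)%E by rewrite yoo.
  rewrite (content_sum_edge c (clopen_cylinder k y) (@subset_refl _ _)).
  apply: lte_sum_pinfty => e /eqP ev; have [z [yz ze]] := graft ev.
  by rewrite -ze cylinder_edge // ltey; apply/eqP => zoo; apply: none; exists z.
pose L k := cylinder k x `\` cylinder k.+1 x.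
have cL k : clopen (L k) by apply: clopenD; exact: clopen_cylinder.
have Lfin k : (n <= k)%N -> (mu (L k) < +oo)%E.
  move=> nk; apply: le_lt_trans (nsplitp (cylinder k.+1 x) _ _ _).
  - apply: (le_content c) => //; first by apply: clopenD; exact: clopen_cylinder.
    apply: setSD; rewrite (cyl_eq px); exact: cyl_le.
  - exact: clopen_cylinder.
  - by rewrite (cyl_eq px); apply: cyl_le; exact: leq_trans nk _.
  - by apply: xoo; exact: leq_trans nk _.
(* [fine] turns infinite terms into 0, which is harmless: a cylinder that branches off x from level
   n on is finite. *)
pose K := \sum_(e : edge B) fine (mu (cylinder 0 (start (tgt e)))).
have K0 : 0 <= K by apply: sumr_ge0 => e _; rewrite fine_ge0.
have LK k : (n <= k)%N -> (mu (L k) <= (K / lam ^+ k.+1)%:E)%E.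
  move=> nk; have sub : L k `<=` cylinder k x by move=> y [].
  rewrite (content_sum_edge c (cL k) sub).
  rewrite /K mulr_suml -sumEFin big_mkcond /=; apply: lee_sum => e _.
  have t0 : (0 <= (fine (mu (cylinder 0 (start (tgt e)))) / lam ^+ k.+1)%:E)%E.
    by rewrite lee_fin mulr_ge0 ?fine_ge0 // invr_ge0 exprn_ge0 // ltW.
  case: eqVneq => // ev; have [z [xz ze]] := graft ev.
  have [exk|exk] := eqVneq e (x k).
    rewrite (_ : _ `&` _ = set0) ?measure0 //; apply/seteqP; split=> y // [[xy nxy] /= ye].
    by apply: nxy; apply/cylS; rewrite ye exk.
  have zL : cylinder k.+1 z `<=` L k.
    move=> y /cylS[zy yz]; split; first exact: cyl_trans zy.
    by move=> /cylS[_ yx]; move: exk; rewrite -ze -yz yx eqxx.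
  apply: (@le_trans _ _ (mu (cylinder k.+1 z))).
    apply: (le_content c); [|exact: clopen_cylinder|].
      by apply: clopenI => //; exact: clopen_edge.
    by rewrite -(cylinder_edge xz) ze => y [[xy _] ye].
  have zfin : mu (cylinder k.+1 z) \is a fin_num.
    rewrite ge0_fin_numE //; apply: le_lt_trans (Lfin k nk).
    by apply: (le_content c) => //; exact: clopen_cylinder.
  have sc : ((lam ^+ k.+1)%:E * mu (cylinder k.+1 z) = mu (cylinder 0 (start (tgt e))))%E.
    apply: (measure_cylinder_shift terminal l0 null cyl).
    by rewrite vertexS ze startP.
  rewrite -sc -(fineK zfin) -EFinM /= lee_fin mulrAC divff ?mul1r //.
  by rewrite expf_neq0 // gt_eqF.
have xZ : ~ class_paths alpha x.
  move=> /(class_pathsP terminal)[k xk].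
  have := terminal_vertex terminal (leq_maxr n k) xk.
  by move=> /cyl; rewrite xoo // leq_maxl.
pose Z : set (borel_bpath B) := ~` class_paths alpha.
have mZ : measurable Z.
  by apply: measurableC; apply: open_measurable_bpath; exact: class_paths_open.
have mL k : measurable (L k : set (borel_bpath B)) by exact: clopen_measurable.
suff : (mu (cylinder n p) < +oo)%E by rewrite poo.
(* The sets L (n + k) cover the cylinder except for x itself, which lies in the null set Z. *)
apply: (@le_lt_trans _ _ (\big[+%E/0%R]_(0 <= k <oo) mu (L (n + k)%N `|` Z))%E).
  apply: measure_sigma_subadditive.
  - by move=> k; exact: measurableU.
  - apply: clopen_measurable; exact: clopen_cylinder.
  rewrite (cyl_eq px) => y xy.
  have [->|yx] := pselect (y = x); first by exists 0%N => //; right.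
  have [k [xk nxk]] : exists k, cylinder (n + k) x y /\ ~ cylinder (n + k).+1 x y.
    apply: contrapT => /forallNP none; apply: yx; apply: bpath_ext => j.
    have H k : cylinder (n + k) x y.
      elim: k => [|k IH]; first by rewrite addn0.
      by apply: contrapT => nk; apply: (none k); rewrite -addnS.
    by case: (H j.+1) => _ ->//; rewrite addnS ltnS leq_addl.
  by exists k => //; left.
apply: (@le_lt_trans _ _ (K / lam ^+ n.+1 * (1 - lam^-1)^-1)%:E); last exact: ltry.
apply: lime_le.
  by apply: is_cvg_nneseries => k _ _; apply: measure_ge0; exact: measurableU.
apply: nearW => N.
have step k : (mu (L (n + k)%N `|` Z) <= (K / lam ^+ n.+1 * lam^-1 ^+ k)%:E)%E.
  rewrite measureU0 //; apply: le_trans (LK _ (leq_addr _ _)) _.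
  by rewrite lee_fin -mulrA -exprVn -exprVn -exprD addSn.
apply: (@le_trans _ _ (\sum_(0 <= k < N) (K / lam ^+ n.+1 * lam^-1 ^+ k)%:E)%E).
  by apply: lee_sum => k _; exact: step.
rewrite sumEFin -mulr_sumr lee_fin ler_wpM2l //.
  by rewrite divr_ge0 // exprn_ge0 // ltW.
by apply: geometric_partial_le; rewrite invr_ge0 ltW //= invf_lt1.
Qed.

End eigen_measure_values.

Section good_measure_values.
Context {R : realType} {B : stationary_diagram}.
Variable mu : {measure set (borel_bpath B) -> \bar R}.
Hypotheses (inf : infinite_measure mu) (good : good_measure mu).

Definition clopen_value (r : \bar R) :=
  (r < +oo)%E /\ exists2 U : set (bpath B), clopen U & mu U = r.

(** The complement of a clopen set of finite measure is infinite, so goodness finds room there for a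
    disjoint set of measure s. *)
Lemma clopen_valueD r s : clopen_value r -> clopen_value s -> clopen_value (r + s)%E.
Proof.
move=> [roo [U cU Ur]] [soo [V cV Vs]]; split; first by rewrite lte_add_pinfty.
have c := measure_clopen_content mu.
have cCU : clopen (~` U) by exact: clopenC.
have [|W [cW WU mW]] := good cV cCU.
  have : mu setT = (mu U + mu (~` U))%E by rewrite -setTD -content_setD //; exact: clopenT.
  rewrite inf Vs Ur; case: (mu (~` U)) => [t| |]; [|by []|].
    by move: roo; case: (r) => //.
  by move: roo; case: (r) => //.
exists (U `|` W); first exact: clopenU.
rewrite (contentU c) // ?Ur ?mW ?Vs //.
by apply/seteqP; split=> x // [Ux /WU].
Qed.

End good_measure_values.

(** * Adding sources in front of a terminal class *)

Section edges.
Context {B : stationary_diagram}.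

Definition edge_between v w (F0 : (0 < inc B w v)%N) : edge B :=
  existT (fun ji : vtx B * vtx B => 'I_(inc B ji.2 ji.1)) (v, w) (Ordinal F0).

Lemma inc_edge (e : edge B) : (0 < inc B (tgt e) (src e))%N.
Proof. exact: leq_ltn_trans (leq0n _) (ltn_ord (tagged e)). Qed.

Lemma class_blockE (A : {set vtx B}) i j :
  class_block A i j = inc B (enum_val j) (enum_val i).
Proof. by rewrite !mxE. Qed.

Lemma infinite_tail_class (x : bpath B) (y : nat -> bpath B) :
  injective y -> (forall n, tail_equiv x (y n)) -> infinite_set (tail_class x).
Proof.
move=> yI xy fin; apply: infinite_nat.
have -> : [set: nat] = y @^-1` tail_class x by apply/seteqP; split=> n // _; exact: xy.
by apply: finite_preimage => // i j _ _; exact: yI.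
Qed.

End edges.

Lemma primitive_mx_reindex n n' (M : 'M[nat]_n) (M' : 'M[nat]_n') (f : 'I_n' -> 'I_n) :
  bijective f -> (forall i j, M' i j = M (f i) (f j)) ->
  primitive_mx M -> primitive_mx M'.
Proof.
move=> fb M'E [m m0 Mm]; exists m => // i j.
have E k i' j' : (M' ^+ k) i' j' = (M ^+ k) (f i') (f j').
  elim: k i' j' => [|k IH] i' j'; first by rewrite !expr0 !mxE (bij_eq fb).
  rewrite !exprS -!mulmxE !mxE (reindex f) /=; last exact: onW_bij.
  by apply: eq_bigr => l _; rewrite M'E IH.
by rewrite E.
Qed.

Section augmented.
Context {B : stationary_diagram}.
Variable alpha : {set vtx B}.
Hypothesis terminal : forall e : edge B, src e \in alpha -> tgt e \in alpha.
Variables (k m : nat).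

Definition augmented_inc : 'M[nat]_(k.+1 + #|alpha|) := \matrix_(i, j)
  match fintype.split i, fintype.split j with
  | inl s, inl t => if s == t then m.+2 else 0%N
  | inl _, inr _ => 0%N
  | inr _, inl _ => 1%N
  | inr a, inr b => inc B (enum_val a) (enum_val b)
  end.

Let splitl (s : 'I_k.+1) : fintype.split (lshift #|alpha| s) = inl s.
Proof. exact: (unsplitK (inl s)). Qed.

Let splitr (a : 'I_#|alpha|) : fintype.split (rshift k.+1 a) = inr a.
Proof. exact: (unsplitK (inr a)). Qed.

Lemma augmented_row i : exists j, augmented_inc i j != 0%N.
Proof.
case: (split_ordP i) => [s ->|a ->].
  by exists (lshift _ s); rewrite mxE splitl eqxx.
by exists (lshift _ ord0); rewrite mxE splitl splitr.
Qed.

Lemma augmented_col j : exists i, augmented_inc i j != 0%N.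
Proof.
case: (split_ordP j) => [s ->|a ->].
  by exists (lshift _ s); rewrite mxE splitl eqxx.
have [w Fw] := inc_col (enum_val a); rewrite -lt0n in Fw.
have wa : w \in alpha by apply: (terminal (e := edge_between Fw)); exact: enum_valP.
exists (rshift _ (enum_rank_in wa w)).
by rewrite mxE !splitr enum_rankK_in // -lt0n.
Qed.

Definition augmented : stationary_diagram :=
  @StationaryDiagram (k + #|alpha|) augmented_inc augmented_row augmented_col.

Definition source (s : 'I_k.+1) : vtx augmented := lshift #|alpha| s.
Definition copy (a : 'I_#|alpha|) : vtx augmented := rshift k.+1 a.

Lemma augmented_vtx (P : vtx augmented -> Prop) :
  (forall s, P (source s)) -> (forall a, P (copy a)) -> forall v, P v.
Proof. by move=> Ps Pa v; case: (@split_ordP k.+1 #|alpha| v) => [s ->|a ->]. Qed.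

Lemma source_inj : injective source. Proof. by move=> s t /(congr1 val) st; exact: val_inj. Qed.
Lemma copy_inj : injective copy. Proof. by move=> a b /(congr1 val)/addnI ab; exact: val_inj. Qed.
Lemma source_copy s a : (source s == copy a) = false. Proof. exact: eq_lrshift. Qed.

Lemma inc_source s t :
  inc augmented (source s) (source t) = if s == t then m.+2 else 0%N.
Proof. by rewrite /= mxE !splitl. Qed.

Lemma inc_copy_source a s : inc augmented (copy a) (source s) = 1%N.
Proof. by rewrite /= mxE splitl splitr. Qed.

Lemma inc_source_copy s a : inc augmented (source s) (copy a) = 0%N.
Proof. by rewrite /= mxE splitl splitr. Qed.

Lemma inc_copy a b : inc augmented (copy a) (copy b) = inc B (enum_val a) (enum_val b).
Proof. by rewrite /= mxE !splitr. Qed.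

Definition copies : {set vtx augmented} := [set copy a | a : 'I_#|alpha|]%SET.

Lemma copy_copies a : copy a \in copies. Proof. exact: imset_f. Qed.

Lemma source_copies s : source s \notin copies.
Proof. by apply/imsetP => -[a _ /eqP]; rewrite source_copy. Qed.

Lemma copies_terminal (e : edge augmented) : src e \in copies -> tgt e \in copies.
Proof.
move=> /imsetP[a _ ea]; have := inc_edge e; rewrite ea.
by elim/augmented_vtx: (tgt e) => [s|b]; rewrite ?inc_source_copy ?copy_copies.
Qed.

Lemma edge_to_source (e : edge augmented) s : tgt e = source s -> src e = source s.
Proof.
move=> es; have := inc_edge e; rewrite es.
elim/augmented_vtx: (src e) => [t|b]; last by rewrite inc_source_copy.
by rewrite inc_source; case: eqP => // ->.
Qed.

Lemma edge_from_source (e : edge augmented) s : src e = source s ->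
  tgt e = source s \/ tgt e \in copies.
Proof.
move=> es; have := inc_edge e; rewrite es.
elim/augmented_vtx: (tgt e) => [t|b] => [|_]; last by right; exact: copy_copies.
by rewrite inc_source; case: eqP => // ->; left.
Qed.

(** The only edges into a source are its own loops. *)
Lemma source_prefix (x : bpath augmented) s n : vertex x n = source s ->
  forall j, (j <= n)%N -> vertex x j = source s.
Proof.
move=> xn j /subnK; move: (n - j)%N => d; elim: d j => [|d IH] j jn; first by rewrite -(add0n j) jn.
apply: edge_to_source; rewrite -vertexS; apply: IH.
by rewrite -jn addSnnS.
Qed.

Lemma not_class_paths (x : bpath augmented) :
  ~ class_paths copies x <-> exists s, forall n, vertex x n = source s.
Proof.
split=> [nx|[s xs] /(class_pathsP copies_terminal)[n]]; last first.
  by rewrite xs (negPf (source_copies s)).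
have xn n : vertex x n \notin copies.
  by apply/negP => xn; apply: nx; apply/(class_pathsP copies_terminal); exists n.
have [s xs] : exists s, vertex x 0 = source s.
  move: (xn 0%N); elim/augmented_vtx: (vertex x 0) => [s _|a]; first by exists s.
  by rewrite copy_copies.
exists s; elim=> // n IH; have := xn n.+1.
by rewrite vertexS; case: (edge_from_source IH) => [->|->].
Qed.

Lemma other_loop s (e : edge augmented) : exists e', [/\ e' != e,
  src e' = source s & tgt e' = source s].
Proof.
have F1 : (1 < inc augmented (source s) (source s))%N by rewrite inc_source eqxx.
have [e1|e1] := eqVneq (edge_between (ltnW F1)) e; last by exists (edge_between (ltnW F1)).
exists (existT (fun ji : vtx augmented * vtx augmented => 'I_(inc augmented ji.2 ji.1))
  (source s, source s) (Ordinal F1)); split=> //.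
by rewrite -e1; apply/eqP => /(congr1 (fun e => nat_of_ord (tagged e))).
Qed.

Lemma exists_source_path s : exists x : bpath augmented, forall n, vertex x n = source s.
Proof.
have F : (0 < inc augmented (source s) (source s))%N by rewrite inc_source eqxx.
by exists (@BPath augmented (fun _ => edge_between F) (fun _ => erefl)).
Qed.

(** As each source has an edge to every copy, a path in the copies is tail equivalent to paths that
    stay at any given source arbitrarily long. *)
Lemma enter_copies n y x s : vertex y n = source s -> vertex x n.+1 \in copies ->
  exists z : bpath augmented, cylinder n y z /\ forall j, (n < j)%N -> z j = x j.
Proof.
move=> ys /imsetP[a _ xa].
have F : (0 < inc augmented (copy a) (source s))%N by rewrite inc_copy_source.
have [z [yz ze]] := @graft augmented n y (edge_between F) (esym ys).
have [|w [zw wx]] := @splice augmented n.+1 z n.+1 x; first by rewrite vertexS ze xa.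
exists w; split; first exact: cyl_trans yz (cyl_le _ zw).
by move=> j nj; rewrite -(subnKC nj) wx.
Qed.

(** A path that reaches the copies is varied by the level at which it leaves a source, a path that
    stays at a source by changing a single loop. *)
Lemma augmented_aperiodic : aperiodic augmented.
Proof.
move=> x; have [/(class_pathsP copies_terminal)[N xN]|] := pselect (class_paths copies x).
  have [s0 s0P] := exists_source_path ord0.
  have /choice[y yP] n : exists z : bpath augmented, cylinder (N + n) s0 z /\
      forall j, (N + n < j)%N -> z j = x j.
    apply: (enter_copies (s0P _)).
    by apply: (terminal_vertex copies_terminal) xN; rewrite -addnS leq_addr.
  apply: (@infinite_tail_class _ x y); last first.
    by move=> n; exists (N + n).+1 => j nj; have [_ ->] := yP n.
  have key i j : (i < j)%N -> y i <> y j.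
    move=> ij yij; have : vertex (y i) (N + i).+1 \in copies.
      have [_ yi] := yP i; rewrite /vertex yi //.
      by apply: (terminal_vertex copies_terminal) xN; rewrite -addnS leq_addr.
    have : cylinder (N + i).+1 s0 (y j).
      by apply: cyl_le (yP j).1; rewrite -addnS leq_add2l.
    by rewrite yij => /cyl_vertex ->; rewrite s0P (negPf (source_copies _)).
  move=> i j yij; case: (ltngtP i j) => // [ij|ji]; first by case: (key _ _ ij).
  by case: (key _ _ ji).
move=> /not_class_paths[s xs].
have /choice[y yP] n : exists z : bpath augmented, z n != x n /\
    forall j, j <> n -> z j = x j.
  have [e [ex es et]] := other_loop s (x n).
  have [z [xz ze]] := @graft augmented n x e (etrans es (esym (xs n))).
  have [|w [zw wx]] := @splice augmented n.+1 z n.+1 x; first by rewrite vertexS ze et xs.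
  exists w; split; first by case: zw => _ ->; rewrite ?ze.
  move=> j /eqP jn; have [jn'|nj|jn'] := ltngtP j n; last by rewrite jn' eqxx in jn.
    by case: zw => _ ->; rewrite ?(ltnW jn') //; [case: xz => _ ->|exact: ltnW].
  by rewrite -(subnKC nj) wx.
apply: (@infinite_tail_class _ x y); last first.
  by move=> n; exists n.+1 => j nj; case: (yP n) => _ -> // jn; rewrite jn ltnn in nj.
move=> i j yij; apply: contrapT => nij.
by have [+ _] := yP i; rewrite yij; have [_ ->] := yP j; rewrite // eqxx.
Qed.

Hypothesis prim : primitive_mx (class_block alpha).

Lemma copy_reach a b : reach (copy a) (copy b).
Proof.
have [l l0 Ml] := prim.
suff H d i j : (0 < (class_block alpha ^+ d) i j)%N -> reach (copy i) (copy j).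
  exact: H (Ml a b).
elim: d i j => [|d IH] i j.
  by rewrite expr0 mxE; case: eqP => [-> _|//]; exact: connect0.
rewrite exprS -mulmxE mxE lt0n sum_nat_eq0 negb_forall => /existsP[c].
rewrite /= mxE [X in (X * _)%R]mxE -lt0n => h.
have {h} /andP[h1 h2] : (0 < inc B (enum_val c) (enum_val i))%N && (0 < (class_block alpha ^+ d) c j)%N.
  by rewrite -muln_gt0.
apply: connect_trans (IH _ _ h2); apply: connect1.
by rewrite inc_copy.
Qed.

Lemma reach_terminal (v w : vtx augmented) : v \in copies -> reach v w -> w \in copies.
Proof.
move=> vc /connectP[p]; elim: p v vc => [|u p IH] v vc /=; first by move=> _ ->.
move=> /andP[vu pp]; apply: IH => //.
exact: (copies_terminal (e := @edge_between augmented _ _ vu) vc).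
Qed.

Lemma reach_source (v : vtx augmented) s : reach v (source s) -> v = source s.
Proof.
move=> /connectP[p]; elim: p v => [|u p IH] v /=; first by move=> _ ->.
move=> /andP[vu pp] /(IH _ pp) us; rewrite us in vu.
exact: (edge_to_source (e := @edge_between augmented _ _ vu)).
Qed.

Lemma scc_copy a : scc (copy a) = copies.
Proof.
apply/setP => v; rewrite inE; apply/andP/imsetP => [[av _]|[b _ ->]].
  by have /imsetP := reach_terminal (copy_copies a) av.
by split; exact: copy_reach.
Qed.

Lemma scc_source s : scc (source s) = [set source s]%SET.
Proof.
apply/setP => v; rewrite !inE; apply/andP/eqP => [[_ /reach_source]//|->].
by split; exact: connect0.
Qed.

Lemma copies_primitive : primitive_mx (class_block copies).
Proof.
have /choice[f fP] (i : 'I_#|copies|) : exists a, enum_val i = copy a.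
  by have /imsetP[a _ ->] := enum_valP i; exists a.
apply: (primitive_mx_reindex (f := f) _ _ prim).
  apply: inj_card_bij.
    by move=> i j fij; apply: enum_val_inj; rewrite !fP fij.
  by rewrite !card_ord card_imset ?card_ord //; exact: copy_inj.
by move=> i j; rewrite !class_blockE !fP inc_copy.
Qed.

Lemma augmented_standing : standing_assumptions augmented.
Proof.
split; first exact: augmented_aperiodic.
move=> A [v ->]; elim/augmented_vtx: v => [s|a] _; last first.
  by rewrite scc_copy; exact: copies_primitive.
exists 1%N => // i j; rewrite expr1 class_blockE.
have E (l : 'I_#|scc (source s)|) : enum_val l = source s.
  have : enum_val l \in scc (source s) := enum_valP l.
  by move: (enum_val l) => v; rewrite scc_source inE => /eqP.
by rewrite !E inc_source eqxx.
Qed.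

Lemma copies_class (a : 'I_#|alpha|) : vertex_class copies.
Proof. by exists (copy a); rewrite scc_copy. Qed.

Lemma augmented_classes (a0 : 'I_#|alpha|) (v : vtx augmented) :
  v \in copies \/ exists beta : {set vtx augmented},
    [/\ vertex_class beta, class_prec beta copies & v \in beta].
Proof.
elim/augmented_vtx: v => [s|a]; last by left; exact: copy_copies.
right; exists (scc (source s)); split; first by exists (source s).
  split.
    move=> e; have := source_copies s; rewrite -e scc_source inE eqxx.
    by [].
  exists (source s), (copy a0); split; first by rewrite scc_source inE.
    exact: copy_copies.
  by apply: connect1; rewrite inc_copy_source.
by rewrite scc_source inE.
Qed.

Definition source_paths (s : 'I_k.+1) : set (bpath augmented) :=
  [set x | forall n, vertex x n = source s].

Lemma source_paths_closed s : closed (source_paths s).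
Proof.
rewrite -openC; apply/openP => x /existsNP[n xn]; exists n => y xy /(_ n).
by rewrite (cyl_vertex xy).
Qed.

Lemma source_paths_invariant s : tail_invariant_set (source_paths s).
Proof.
move=> x y [n xy] xs j; apply: (source_prefix (n := maxn n j)); last exact: leq_maxr.
by rewrite /vertex -xy ?leq_maxl // -/(vertex x _) xs.
Qed.

Lemma source_paths_dense s x : source_paths s x ->
  source_paths s `<=` closure (tail_class x).
Proof.
move=> xs y ys; apply/closure_cylinder => n.
have [|z [yz zx]] := @splice augmented n y n x; first by rewrite ys xs.
by exists z; split=> //; exists n => j nj; rewrite -(subnKC nj) zx.
Qed.

Lemma source_paths_minimal s : minimal_component (source_paths s).
Proof.
split; [by have [x xs] := exists_source_path s; exists x|exact: source_paths_closed|
  exact: source_paths_invariant|by move=> x; exact: source_paths_dense].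
Qed.

(** C contains a path that stays at a source: either one of its paths does, or such a path is a
    limit of tail equivalent ones by [enter_copies]. The class of that path is dense both in C and
    in its source set. *)
Lemma minimal_component_source C : minimal_component C ->
  exists s, C = source_paths s.
Proof.
move=> [[x Cx] cC iC dC].
have classC z : C z -> closure (tail_class z) `<=` C.
  by move=> Cz; apply: closure_sub_closed => // w zw; exact: iC zw Cz.
have [s [z [Cz zs]]] : exists s z, C z /\ source_paths s z.
  have [/(class_pathsP copies_terminal)[N xN]|/not_class_paths[s xs]] :=
    pselect (class_paths copies x); last by exists s, x.
  have [y ys] := exists_source_path ord0; exists ord0, y; split=> //.
  apply: (classC x) => //; apply/closure_cylinder => n.
  have [|z [yz zx]] := @enter_copies (maxn n N) y x ord0 (ys _).
    by apply: (terminal_vertex copies_terminal) xN; rewrite leqW // leq_maxr.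
  exists z; split; last by apply: cyl_le yz; exact: leq_maxl.
  by exists (maxn n N).+1 => j nj; rewrite zx.
exists s; apply/seteqP; split; last first.
  by apply: subset_trans (classC _ Cz); exact: source_paths_dense.
apply: subset_trans (dC _ Cz) _; apply: closure_sub_closed.
  exact: source_paths_closed.
by move=> w zw; exact: source_paths_invariant zw zs.
Qed.

Lemma card_minimal_components :
  [set C : set (bpath augmented) | minimal_component C] #= `I_k.+1.
Proof.
have -> : [set C : set (bpath augmented) | minimal_component C] =
    (fun j => source_paths (inord j)) @` `I_k.+1.
  apply/seteqP; split=> [C /minimal_component_source[s ->]|_ [j _ <-]].
    by exists s => /=; [exact: ltn_ord|rewrite inord_val].
  exact: source_paths_minimal.
apply: inj_card_eq => i j; rewrite !inE /= => ik jk ij.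
have [x xs] := exists_source_path (inord i).
have : source_paths (inord j) x by rewrite -ij.
move=> /(_ 0%N); rewrite xs => /source_inj /(congr1 val).
by rewrite /= !inordK.
Qed.

End augmented.

(** * The measure on the diagram with sources *)

(** The inductive step for constructions down the tree: edge n of a path selects the child whose W e
    is to be used. *)
Lemma glue_children {B : stationary_diagram} n (q : bpath B) (W : edge B -> set (bpath B)) :
  (forall e, src e = vertex q n ->
     clopen (W e) /\ W e `<=` cylinder n.+1 (extend n q e)) ->
  exists V, [/\ clopen V, V `<=` cylinder n q &
    forall (R : realType) (c : set (bpath B) -> \bar R), clopen_content c ->
      c V = (\sum_(e | src e == vertex q n) c (W e))%E].
Proof.
move=> WP; pose V := cylinder n q `&` [set y : bpath B | W (y n) y].
have cV : clopen V.
  apply/clopenP => x; have [qx|nqx] := pselect (cylinder n q x); last first.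
    exists n => y xy; split=> -[qy _]; case: nqx => //.
    by apply: cyl_trans qy _; exact: cyl_sym.
  have [/clopenP/(_ x)[j jW] _] := WP (x n) (cyl_vertex qx).
  exists (maxn j n.+1) => y xy.
  have /cylS[xy' yx] := cyl_le (leq_maxr j n.+1) xy.
  have := jW _ (cyl_le (leq_maxl j n.+1) xy).
  rewrite /V /setI /= yx; have : cylinder n q y by exact: cyl_trans xy'.
  by tauto.
exists V; split=> // [x []//|R c cc].
rewrite (content_sum_edge cc cV (@subIsetl _ _ _)); apply: eq_bigr => e /eqP ev.
have [_ We] := WP _ ev; have [qz ze] := extendP ev.
congr (c _); apply/seteqP; split=> x /=; first by move=> [[_ Wx] <-].
move=> Wx; have /cylS[zx xe] := We _ Wx; rewrite ze in xe.
by rewrite /V /= xe; split=> //; split=> //; exact: cyl_trans zx.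
Qed.

Lemma edge_ext {B : stationary_diagram} (e f : edge B) : src e = src f -> tgt e = tgt f ->
  nat_of_ord (tagged e) = nat_of_ord (tagged f) -> e = f.
Proof.
case: e f => [[v w] i] [[v' w'] j]; rewrite /src /tgt /= => vv ww; subst v' w'.
by move=> /val_inj ->.
Qed.

Section augmented_content.
Context {R : realType} {B : stationary_diagram}.
Variables (alpha : {set vtx B}) (lam : R) (xi : vtx B -> R).
Variable mu : {measure set (borel_bpath B) -> \bar R}.
Hypothesis terminal : forall e : edge B, src e \in alpha -> tgt e \in alpha.
Hypothesis eig : eigen_measure alpha mu lam xi.
Variables (k m : nat).
Hypothesis lam_le : lam <= m.+2%:R.

Local Notation D := (augmented terminal k m).
Local Notation copy := (copy terminal k m).
Local Notation source := (@source B alpha terminal k m).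

Let l0 : 0 < lam. Proof. by case: eig => l1 *; exact: lt_trans l1. Qed.
Let xi0 (a : 'I_#|alpha|) : 0 < xi (enum_val a).
Proof. by case: eig => _ + _ _ _; apply; exact: enum_valP. Qed.

(** An edge is a pair of endpoints with a number. phi and psi keep the number; as alpha is terminal,
    all targets have copies. *)
Lemma copy_edges (a : 'I_#|alpha|) :
  exists (phi : edge B -> edge D) (psi : edge D -> edge B),
  (forall e, src e = enum_val a -> src (phi e) = copy a /\ psi (phi e) = e) /\
  (forall e, src e = copy a -> [/\ src (psi e) = enum_val a, phi (psi e) = e &
     exists b, tgt e = copy b /\ tgt (psi e) = enum_val b]).
Proof.
pose rel (e : edge B) (f : edge D) := [/\ src e = enum_val a, src f = copy a,
  exists b, tgt f = copy b /\ tgt e = enum_val b &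
  nat_of_ord (tagged e) = nat_of_ord (tagged f)].
have relI e e' f : rel e f -> rel e' f -> e = e'.
  move=> [ea fa [b [fb eb]] ef] [e'a _ [b' [fb' e'b']] e'f].
  apply: edge_ext; [by rewrite ea|rewrite eb e'b'|by rewrite ef].
  by congr enum_val; apply: (@copy_inj _ _ terminal k m); rewrite -fb.
have relI' e f f' : rel e f -> rel e f' -> f = f'.
  move=> [ea fa [b [fb eb]] ef] [_ f'a [b' [fb' eb']] ef'].
  apply: edge_ext; [by rewrite fa|rewrite fb fb'|by rewrite -ef].
  by congr (copy _); apply: enum_val_inj; rewrite -eb.
have /choice[phi phiP] (e : edge B) : exists f : edge D, src e = enum_val a -> rel e f.
  have [ea|nea] := pselect (src e = enum_val a); last by exists ((point : bpath D) 0%N).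
  have ta : tgt e \in alpha by apply: terminal; rewrite ea enum_valP.
  have tE := enum_rankK_in ta ta; set b := enum_rank_in ta (tgt e) in tE.
  have F : (tagged e < inc D (copy b) (copy a))%N.
    by rewrite inc_copy tE -ea; exact: ltn_ord.
  exists (existT (fun ji : vtx D * vtx D => 'I_(inc D ji.2 ji.1)) (copy a, copy b) (Ordinal F)).
  by move=> _; split=> //; exists b.
have /choice[psi psiP] (f : edge D) : exists e : edge B, src f = copy a -> rel e f.
  have [fa|nfa] := pselect (src f = copy a); last by exists ((point : bpath B) 0%N).
  have /imsetP[b _ fb] : tgt f \in copies terminal k m.
    by apply: copies_terminal; rewrite fa copy_copies.
  have F : (tagged f < inc B (enum_val b) (enum_val a))%N.
    by rewrite -(inc_copy terminal k m) -fb -fa; exact: ltn_ord.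
  exists (existT (fun ji : vtx B * vtx B => 'I_(inc B ji.2 ji.1)) (enum_val a, enum_val b) (Ordinal F)).
  by move=> _; split=> //; exists b.
exists phi, psi; split=> [e ea|f fa].
  have r := phiP _ ea; have [_ fa _ _] := r; split=> //.
  exact: relI (psiP _ fa) r.
have r := psiP _ fa; have [ea _ fb _] := r; split=> //.
exact: relI' (phiP _ ea) r.
Qed.

Definition augmented_xi (v : vtx D) : R :=
  if fintype.split (v : 'I_(k.+1 + #|alpha|)) is inr a then xi (enum_val a) else 0.

Lemma augmented_xi_copy a : augmented_xi (copy a) = xi (enum_val a).
Proof. by rewrite /augmented_xi (unsplitK (inr a)). Qed.

Definition augmented_weight n (v : vtx D) : \bar R :=
  if v \in copies terminal k m then (augmented_xi v / lam ^+ n)%:E else +oo%E.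

Lemma augmented_weight_copy n a :
  augmented_weight n (copy a) = (xi (enum_val a) / lam ^+ n)%:E.
Proof. by rewrite /augmented_weight copy_copies augmented_xi_copy. Qed.

Lemma augmented_weight_source n s : augmented_weight n (source s) = +oo%E.
Proof. by rewrite /augmented_weight (negPf (source_copies _ _ _)). Qed.

Lemma augmented_weight_gt0 n v : (0 < augmented_weight n v)%E.
Proof.
elim/(@augmented_vtx _ _ terminal k m): v => [s|a]; first by rewrite augmented_weight_source ltry.
by rewrite augmented_weight_copy lte_fin divr_gt0 // exprn_gt0.
Qed.

Lemma sum_copy_edges (V : nmodType) a (F : vtx D -> V) :
  \sum_(e : edge D | src e == copy a) F (tgt e) =
  \sum_(b < #|alpha|) F (copy b) *+ inc B (enum_val b) (enum_val a).
Proof.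
transitivity (\sum_(w : 'I_(k.+1 + #|alpha|)) F w *+ inc D w (copy a)); first exact: sum_edges.
rewrite big_split_ord /= [X in X + _]big1 ?add0r => [|s _].
  by apply: eq_bigr => b _; rewrite -(inc_copy terminal k m).
by rewrite -[augmented_inc _ _ _ _ _]/(inc D (source s) (copy a)) inc_source_copy.
Qed.

Lemma augmented_eigen a :
  \sum_(e : edge D | src e == copy a) augmented_xi (tgt e) = lam * xi (enum_val a).
Proof.
case: eig => _ _ Axi _ _; rewrite -Axi ?enum_valP // (sum_edges_class terminal xi).
rewrite sum_copy_edges; apply: eq_bigr => b _.
by rewrite augmented_xi_copy class_blockE.
Qed.

Lemma augmented_weight_sum n v : augmented_weight n v =
  (\sum_(e : edge D | src e == v) augmented_weight n.+1 (tgt e))%E.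
Proof.
elim/(@augmented_vtx _ _ terminal k m): v => [s|a].
  have [e [_ es et]] := @other_loop _ _ terminal k m s ((point : bpath D) 0%N).
  rewrite augmented_weight_source (bigD1 e) ?es ?eqxx //= et augmented_weight_source.
  by rewrite addye // gt_eqF // (lt_le_trans (ltNyr 0)) // sume_ge0 // => i _; exact: ltW (augmented_weight_gt0 _ _).
rewrite augmented_weight_copy.
transitivity (\sum_(e : edge D | src e == copy a) (augmented_xi (tgt e) / lam ^+ n.+1)%:E)%E.
  rewrite sumEFin -mulr_suml augmented_eigen exprS; congr (_%:E).
  by have := l0; move: (lam ^+ n) (lt0r_neq0 (exprn_gt0 n l0)) => c c0 ll; field; rewrite c0 gt_eqF.
apply: eq_bigr => e /eqP ea; have : tgt e \in copies terminal k m.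
  by apply: copies_terminal; rewrite ea copy_copies.
by rewrite /augmented_weight => ->.
Qed.

Definition augmented_content : set (bpath D) -> \bar R := weight_content augmented_weight.

Lemma augmented_contentP : clopen_content augmented_content.
Proof.
apply: weight_contentP; last exact: augmented_weight_sum.
by move=> n v; exact: ltW (augmented_weight_gt0 _ _).
Qed.

Lemma augmented_content_cylinder n p :
  augmented_content (cylinder n p) = augmented_weight n (vertex p n).
Proof.
by apply: weight_content_cylinder; exact: augmented_weight_sum.
Qed.

Local Notation nu := augmented_content.
Let cnu := augmented_contentP.
Let cmu := measure_clopen_content mu.

Lemma augmented_content_positive : positive_content nu.
Proof.
move=> U cU U0; apply/seteqP; split=> // x Ux.
have [/openP/(_ x Ux)[n nU] _] := cU.
have := le_content cnu (clopen_cylinder n x) cU nU.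
by rewrite U0 augmented_content_cylinder leNgt augmented_weight_gt0.
Qed.

Lemma infinite_source_cylinder U : clopen U -> nu U = +oo%E ->
  exists n p s, cylinder n p `<=` U /\ vertex p n = source s.
Proof.
move=> cU Uoo; apply: contrapT => none.
suff : (nu U < +oo)%E by rewrite Uoo.
apply: (@clopen_ind D (fun V => nu V < +oo)%E) => //.
- by rewrite (content0 cnu).
- by move=> V W cV cW VW Voo Woo; rewrite (contentU cnu) // lte_add_pinfty.
move=> n p pU; rewrite augmented_content_cylinder.
move E: (vertex p n) => v; elim/(@augmented_vtx _ _ terminal k m): v E => [s|a] E.
  by case: none; exists n, p, s.
by rewrite augmented_weight_copy ltry.
Qed.

(** Two different loops at a source continue its cylinder to two disjoint infinite ones. *)
Lemma augmented_content_splits : splits_infinite nu.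
Proof.
move=> U cU /(infinite_source_cylinder cU)[n [p [s [pU ps]]]].
have [e [_ es et]] := @other_loop _ _ terminal k m s ((point : bpath D) 0%N).
have [f [fe fs ft]] := @other_loop _ _ terminal k m s e.
have [|x [px xe]] := @graft D n p e; first by rewrite es ps.
have [|y [py yf]] := @graft D n p f; first by rewrite fs ps.
have xU : cylinder n.+1 x `<=` U.
  by apply: subset_trans pU; rewrite (cyl_eq px); exact: cyl_le.
have oo (z : bpath D) g : z n = g -> tgt g = source s -> nu (cylinder n.+1 z) = +oo%E.
  by move=> zg gs; rewrite augmented_content_cylinder vertexS zg gs augmented_weight_source.
exists (cylinder n.+1 x); split=> //; [exact: clopen_cylinder|exact: oo et|].
apply/eqP; rewrite -leye_eq -(oo y f yf ft); apply: (le_content cnu).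
- exact: clopen_cylinder.
- by apply: clopenD => //; exact: clopen_cylinder.
move=> z /cylS[yz zf]; split; first by apply: pU; exact: cyl_trans yz.
by move=> /cylS[_ zx]; move: fe; rewrite -yf -zf zx xe eqxx.
Qed.
Hypotheses (inf : infinite_measure mu) (good : good_measure mu).

Lemma eigen_cylinder n p : vertex p n \in alpha ->
  mu (cylinder n p) = (xi (vertex p n) / lam ^+ n)%:E.
Proof. by case: eig => _ _ _ _; apply. Qed.

Lemma augmented_content_value U : clopen U -> (nu U < +oo)%E -> clopen_value mu (nu U).
Proof.
move=> cU; apply: (@clopen_ind D (fun V => nu V < +oo -> clopen_value mu (nu V))%E) => //.
- rewrite (content0 cnu) => _; split=> //; exists set0; [exact: clopen0|exact: measure0].
- move=> V W cV cW VW PV PW VWoo; rewrite (contentU cnu) //.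
  apply: (clopen_valueD inf good); [apply: PV|apply: PW]; apply: le_lt_trans VWoo.
    by apply: (le_content cnu); [done|exact: clopenU|exact: subsetUl].
  by apply: (le_content cnu); [done|exact: clopenU|exact: subsetUr].
move=> n p _; rewrite augmented_content_cylinder.
elim/(@augmented_vtx _ _ terminal k m): (vertex p n) => [s|a].
  by rewrite augmented_weight_source.
rewrite augmented_weight_copy => _; split; first exact: ltry.
have [x xa] := exists_path_to n (enum_val a).
exists (cylinder n x); first exact: clopen_cylinder.
by rewrite eigen_cylinder xa // enum_valP.
Qed.

Lemma augmented_transfers_from : transfers nu mu.
Proof.
move=> U V cU cV UV; have Uoo : (nu U < +oo)%E by apply: lt_le_trans UV (leey _).
have [_ [U' cU' U'U]] := augmented_content_value cU Uoo.
have [|W [cW WV mW]] := good cU' cV; first by rewrite U'U.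
by exists W; rewrite mW.
Qed.

(** The trees below a and below its copy are isomorphic through [copy_edges], with equal measures at
    equal levels. *)
Lemma copy_transport d n p q a U : vertex p n = enum_val a -> vertex q n = copy a ->
  of_level (n + d) U -> U `<=` cylinder n p ->
  exists W, [/\ clopen W, W `<=` cylinder n q & nu W = mu U].
Proof.
elim: d n p q a U => [|d IH] n p q a U pa qa lU Up.
  have [Up'|nUp] := pselect (U p).
    have -> : U = cylinder n p.
      by apply/seteqP; split=> // x px; rewrite addn0 in lU; apply: (lU _ _ px).1.
    exists (cylinder n q); split=> //; first exact: clopen_cylinder.
    by rewrite augmented_content_cylinder qa augmented_weight_copy eigen_cylinder pa // enum_valP.
  have -> : U = set0.
    apply/seteqP; split=> // x Ux; apply: nUp; rewrite addn0 in lU.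
    exact: (lU _ _ (Up _ Ux)).2.
  by exists set0; rewrite measure0 (content0 cnu); split=> //; exact: clopen0.
have cU := of_level_clopen lU.
have [phi [psi [phiP psiP]]] := copy_edges a.
have /choice[W WP] (f : edge D) : exists W, src f = vertex q n ->
    [/\ clopen W, W `<=` cylinder n.+1 (extend n q f) &
        nu W = mu (U `&` [set x : bpath B | x n = psi f])].
  have [fq|nfq] := pselect (src f = vertex q n); last by exists set0.
  have [ea _ [b [fb eb]]] := psiP f (etrans fq qa).
  have [|x [px xe]] := @graft B n p (psi f); first by rewrite ea pa.
  have [||||V VP] := IH n.+1 x (extend n q f) b (U `&` [set y : bpath B | y n = psi f]).
  - by rewrite vertexS xe.
  - by rewrite vertex_extend.
  - move=> y z yz; have yz' := cyl_le (leq_addr d n.+1) yz.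
    have := lU y z; rewrite addnS -addSn => /(_ yz) UyUz.
    have [_ zy] := (cylS n y z).1 yz'.
    by rewrite /setI /= zy; tauto.
  - by move=> y [Uy ye]; apply/cylS; split; [apply: cyl_trans (Up _ Uy); exact: cyl_sym|rewrite xe].
  - by exists V.
have [f /WP[]//|V [cV Vq Vsum]] := @glue_children D n q W.
exists V; split=> //; rewrite (Vsum _ _ cnu) (content_sum_edge cmu cU Up) pa qa.
rewrite [RHS](reindex_onto psi phi) /=; last by move=> e /eqP/phiP[].
apply: eq_big => [f|f /eqP fa]; last by have [] := WP f (etrans fa (esym qa)).
apply/eqP/andP => [fa|[/eqP ea /eqP <-]]; first by have [-> -> _] := psiP f fa.
by have [] := phiP _ ea.
Qed.

(** The weak inequality lets the induction over disjoint unions fill Q1 exactly with a part of P and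
    put the rest into Q2. For a cylinder ending in a copy, goodness of mu moves P into a cylinder of
    B ending in the original vertex, from where [copy_transport] takes it. *)
Lemma augmented_transfers_finite Q : clopen Q -> (nu Q < +oo)%E ->
  forall P, clopen P -> (mu P <= nu Q)%E ->
  exists W, [/\ clopen W, W `<=` Q & nu W = mu P].
Proof.
move=> cQ; apply: (@clopen_ind D (fun Q => nu Q < +oo -> forall P, clopen P ->
  mu P <= nu Q -> exists W, [/\ clopen W, W `<=` Q & nu W = mu P])%E) => //.
- move=> _ P cP; rewrite (content0 cnu) => P0; exists set0.
  split=> //; first exact: clopen0.
  by rewrite (content0 cnu); apply/eqP; rewrite eq_le P0 measure_ge0.
- move=> Q1 Q2 cQ1 cQ2 Q12 H1 H2 Qoo P cP.
  have Q1oo : (nu Q1 < +oo)%E.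
    by apply: le_lt_trans Qoo; apply: (le_content cnu); [done|exact: clopenU|exact: subsetUl].
  have Q2oo : (nu Q2 < +oo)%E.
    by apply: le_lt_trans Qoo; apply: (le_content cnu); [done|exact: clopenU|exact: subsetUr].
  have [PQ1 _|Q1P] := leP (mu P) (nu Q1).
    have [W [cW WQ mW]] := H1 Q1oo P cP PQ1.
    by exists W; split=> // x /WQ; left.
  have [P1 [cP1 P1P mP1]] := augmented_transfers_from cQ1 cP Q1P.
  rewrite (contentU cnu) // (content_setD cmu cP cP1 P1P) mP1 => PQ.
  have cPD : clopen (P `\` P1) by exact: clopenD.
  have PD2 : (mu (P `\` P1) <= nu Q2)%E.
    by move: PQ; rewrite leeD2lE // ge0_fin_numE // (content_ge0 cnu).
  have [W [cW WQ mW]] := H2 Q2oo _ cPD PD2.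
  exists (Q1 `|` W); split; first exact: clopenU.
    by move=> x [|/WQ]; [left|right].
  rewrite (contentU cnu) // ?mW //.
  by apply/seteqP; split=> x // -[Q1x /WQ Q2x]; rewrite -Q12.
move=> n q _; rewrite augmented_content_cylinder.
move E: (vertex q n) => v; elim/(@augmented_vtx _ _ terminal k m): v E => [s|a] qa.
  by rewrite augmented_weight_source.
rewrite augmented_weight_copy => _ P cP PQ.
have [x xa] := exists_path_to n (enum_val a).
have xm : mu (cylinder n x) = (xi (enum_val a) / lam ^+ n)%:E.
  by rewrite eigen_cylinder xa // enum_valP.
move: PQ; rewrite -xm le_eqVlt => /predU1P[->|].
  exists (cylinder n q); split=> //; first exact: clopen_cylinder.
  by rewrite augmented_content_cylinder qa augmented_weight_copy xm.
move=> /(good cP (clopen_cylinder n x))[P' [cP' P'x <-]].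
have [N lP'] := clopen_of_level cP'.
by apply: (copy_transport xa qa (of_level_le (leq_addl n N) lP')).
Qed.

(* Each level multiplies the number of source cylinders by m.+2 >= lam, so    *)
(* that the copies entered at each level contribute at least c to the sum.    *)
Lemma source_cylinder_unbounded (a0 : 'I_#|alpha|) K n q s : vertex q n = source s ->
  exists Q, [/\ clopen Q, Q `<=` cylinder n q, (nu Q < +oo)%E &
    ((K%:R * (xi (enum_val a0) / lam) / lam ^+ n)%:E <= nu Q)%E].
Proof.
elim: K n q => [|K IH] n q qs.
  exists set0; rewrite (content0 cnu) !mul0r; split=> //; exact: clopen0.
set c := xi (enum_val a0) / lam; have c0 : 0 <= c by rewrite divr_ge0 ?ltW.
(* A lower bound for what is placed below an edge to w: the induction hypothesis at the source, one
   whole cylinder at the copy of a0, nothing elsewhere. *)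
pose g (w : vtx D) : R := if w == source s then K%:R * c / lam ^+ n.+1
  else if w == copy a0 then c / lam ^+ n else 0.
have /choice[W WP] (f : edge D) : exists W, src f = vertex q n ->
    [/\ clopen W, W `<=` cylinder n.+1 (extend n q f), (nu W < +oo)%E &
        ((g (tgt f))%:E <= nu W)%E].
  have [fq|nfq] := pselect (src f = vertex q n); last by exists set0.
  have tE := vertex_extend fq.
  rewrite /g; case: eqVneq => [fs|_].
    have [|Q [cQ Qq Qoo KQ]] := IH n.+1 (extend n q f); first by rewrite tE.
    by exists Q.
  case: eqVneq => [fa|_].
    exists (cylinder n.+1 (extend n q f)) => _; split=> //; first exact: clopen_cylinder.
      by rewrite augmented_content_cylinder tE fa augmented_weight_copy ltry.
    rewrite augmented_content_cylinder tE fa augmented_weight_copy lee_fin exprS.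
    by rewrite /c invfM !mulrA.
  by exists set0; rewrite (content0 cnu); split=> //; exact: clopen0.
have [f /WP[]//|V [cV Vq Vsum]] := @glue_children D n q W.
exists V; split=> //; rewrite (Vsum _ _ cnu).
  by apply: lte_sum_pinfty => f /eqP/WP[].
apply: (@le_trans _ _ (\sum_(f : edge D | src f == vertex q n) (g (tgt f))%:E)%E); last first.
  by apply: lee_sum => f /eqP/WP[].
rewrite sumEFin lee_fin qs sum_edges.
pose h w := g w *+ inc D w (source s).
have h0 w : 0 <= h w.
  rewrite /h mulrn_wge0 // /g.
  by do 2?case: ifP => _ //; rewrite ?mulr_ge0 ?invr_ge0 ?exprn_ge0 // ltW.
have hs : h (source s) = K%:R * c / lam ^+ n.+1 *+ m.+2 by rewrite /h /g inc_source !eqxx.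
have ha : h (copy a0) = c / lam ^+ n.
  by rewrite /h /g inc_copy_source [copy a0 == source s]eq_sym source_copy eqxx.
suff : K.+1%:R * c / lam ^+ n <= \sum_w h w by [].
rewrite (bigD1 (source s)) // (bigD1 (copy a0)) /=; last by rewrite eq_sym source_copy.
rewrite hs ha addrA -[leLHS]addr0 lerD //; last by apply: sumr_ge0.
rewrite -[K.+1]addn1 natrD !mulrDl mul1r lerD2r.
have -> : K%:R * c / lam ^+ n.+1 *+ m.+2 = K%:R * c / lam ^+ n * (m.+2%:R / lam).
  rewrite -mulr_natr exprS; move: (lam ^+ n) (lt0r_neq0 (exprn_gt0 n l0)) => a an.
  by field; rewrite an gt_eqF.
apply: ler_peMr; last by rewrite ler_pdivlMr // mul1r.
by rewrite !mulr_ge0 ?invr_ge0 ?exprn_ge0 // ltW.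
Qed.

Lemma augmented_transfers_to (a0 : 'I_#|alpha|) : transfers mu nu.
Proof.
move=> P Q cP cQ PQ; have [Qoo|] := ltP (nu Q) +oo%E.
  exact: (augmented_transfers_finite cQ Qoo cP (ltW PQ)).
rewrite leye_eq => /eqP Qoo.
have [n [q [s [qQ qs]]]] := infinite_source_cylinder cQ Qoo.
have Pfin : mu P \is a fin_num by rewrite ge0_fin_numE // -Qoo.
set c := xi (enum_val a0) / lam / lam ^+ n.
have c0 : 0 < c by rewrite !divr_gt0 // exprn_gt0.
have [Q' [cQ' Q'q Q'oo KQ]] := source_cylinder_unbounded a0 (Num.bound (fine (mu P) / c)) qs.
have [|W [cW WQ' mW]] := augmented_transfers_finite cQ' Q'oo cP.
  apply: le_trans KQ; rewrite -(fineK Pfin) lee_fin -mulrA -/c -ler_pdivrMr //.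
  by apply: ltW; apply: archi_boundP; rewrite divr_ge0 ?fine_ge0 // ltW.
exists W; split=> //; apply: subset_trans WQ' _; exact: subset_trans Q'q qQ.
Qed.

Lemma augmented_content_infinite : nu setT = +oo%E.
Proof.
have [x xs] := exists_source_path terminal m (ord0 : 'I_k.+1).
apply/eqP; rewrite -leye_eq -(augmented_weight_source 0 ord0) -(xs 0%N).
rewrite -augmented_content_cylinder; apply: (le_content cnu) => //.
  exact: clopen_cylinder.
exact: clopenT.
Qed.

End augmented_content.

(** * Orbit equivalence and conclusion *)

Section orbit_equivalence.

Lemma homeomorphism_id (T : topologicalType) : homeomorphism (@id T).
Proof. by split=> [x|]; [exact: cvg_id|exists id; split=> // x; exact: cvg_id]. Qed.

Lemma orbit_equivalent_refl B : orbit_equivalent B B.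
Proof.
exists id; split; first exact: homeomorphism_id.
by move=> x; rewrite image_id.
Qed.

Lemma image_cancel (T U : Type) (h : T -> U) (g : U -> T) (A : set T) :
  cancel h g -> g @` (h @` A) = A.
Proof.
move=> hK; apply/seteqP; split=> [_ [_ [x Ax <-] <-]|x Ax]; first by rewrite hK.
by exists (h x) => //; exists x.
Qed.

Lemma minimal_component_image B1 B2 (h : bpath B1 -> bpath B2) (g : bpath B2 -> bpath B1) C :
  continuous h -> continuous g -> cancel h g -> cancel g h ->
  (forall x, h @` tail_class x = tail_class (h x)) ->
  minimal_component C -> minimal_component (h @` C).
Proof.
move=> ch cg hK gK hc [[c Cc] cC iC dC].
have imE : h @` C = g @^-1` C.
  by apply/seteqP; split=> [_ [x Cx <-]|y Cy]; rewrite /preimage /= ?hK //; exists (g y).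
split.
- by exists (h c), c.
- by rewrite imE; apply: closed_comp => // x _; exact: cg.
- move=> y' y + [x Cx xy']; rewrite -xy' => xy; have : tail_class (h x) y by [].
  by rewrite -hc => -[z xz <-]; exists z => //; exact: iC xz Cx.
- move=> _ [x Cx <-] _ [z Cz <-] V nV.
  have [|w [xw Vw]] := dC x Cx z Cz (h @^-1` V); first exact: ch.
  by exists (h w); split=> //; rewrite -hc; exists w.
Qed.

Lemma orbit_equivalent_minimal_components B1 B2 : orbit_equivalent B1 B2 ->
  [set C : set (bpath B1) | minimal_component C] #=
  [set C : set (bpath B2) | minimal_component C].
Proof.
move=> [h [[ch [g [hK gK cg]]] hc]].
have gc y : g @` tail_class y = tail_class (g y).
  by rewrite -[in LHS](gK y) -hc image_cancel.
have -> : [set C : set (bpath B2) | minimal_component C] =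
    (fun C => h @` C) @` [set C : set (bpath B1) | minimal_component C].
  apply/seteqP; split=> [C mC|_ [C mC <-]].
    exists (g @` C); first exact: (minimal_component_image cg ch gK hK gc).
    exact: image_cancel.
  exact: (minimal_component_image ch cg hK gK hc).
rewrite card_eq_sym; apply: inj_card_eq => C C' _ _ CC'.
by rewrite -(image_cancel C hK) CC' image_cancel.
Qed.

End orbit_equivalence.

Section realization.
Context {R : realType} {B : stationary_diagram}.
Variables (alpha : {set vtx B}) (lam : R) (xi : vtx B -> R).
Variable mu : {measure set (borel_bpath B) -> \bar R}.
Hypothesis terminal : forall e : edge B, src e \in alpha -> tgt e \in alpha.
Hypothesis eig : eigen_measure alpha mu lam xi.
Hypothesis prim : primitive_mx (class_block alpha).
Hypotheses (full : full_measure mu) (inf : infinite_measure mu) (good : good_measure mu).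
Variables (a0 : 'I_#|alpha|) (k m : nat).
Hypothesis lam_le : lam <= m.+2%:R.

Local Notation D := (augmented terminal k m).
Local Notation nu := (@augmented_content R B alpha lam xi terminal k m).

Lemma augmented_homeomorphism : exists h : bpath B -> bpath D,
  homeomorphism h /\ forall V, clopen V -> mu (h @^-1` V) = nu V.
Proof.
apply: back_and_forth.
- exact: measure_clopen_content.
- exact: (augmented_contentP terminal eig).
- exact: full_positive_content.
- exact: (augmented_content_positive eig).
- exact: (eigen_measure_splits_infinite terminal eig).
- exact: (augmented_content_splits eig).
- exact: (augmented_transfers_to eig lam_le inf good a0).
- exact: (augmented_transfers_from eig inf good).
- by rewrite inf (augmented_content_infinite terminal eig).
Qed.

Lemma augmented_measure : exists mu' : {measure set (borel_bpath D) -> \bar R},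
  [/\ ergodic_invariant_measure mu', infinite_measure mu', good_measure mu' &
      homeomorphic_measures mu' mu].
Proof.
have [h [[ch [g [hK gK cg]]] hnu]] := augmented_homeomorphism.
have mh : measurable_fun setT (h : borel_bpath B -> borel_bpath D).
  exact: continuous_measurable_bpath.
pose mu' : {measure set (borel_bpath D) -> \bar R} := image_measure mu mh.
have mu'E A : mu' A = mu (h @^-1` A) by [].
have [l1 xi0 _ null cyl] := eig.
have ct := @copies_terminal _ _ terminal k m.
have oA : open (class_paths alpha) by exact: class_paths_open.
have oA' : open (class_paths (copies terminal k m)) by exact: class_paths_open.
have mZ : measurable (~` class_paths alpha : set (borel_bpath B)).
  by apply: measurableC; exact: open_measurable_bpath.
have mZ' : measurable (~` class_paths (copies terminal k m) : set (borel_bpath D)).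
  by apply: measurableC; exact: open_measurable_bpath.
have hg V : h @^-1` (g @^-1` V) = V.
  by apply/seteqP; split=> x; rewrite /preimage /= hK.
have eig' : eigen_measure (copies terminal k m) mu' lam (augmented_xi xi (terminal := terminal) (k := k) (m := m)).
  split=> //.
  - by move=> v /imsetP[a _ ->]; rewrite augmented_xi_copy xi0 // enum_valP.
  - by move=> v /imsetP[a _ ->]; rewrite (augmented_eigen terminal eig) augmented_xi_copy.
  - apply/eqP; rewrite eq_le measure_ge0 andbT mu'E -null.
    apply: le_measure; rewrite ?inE //.
      by rewrite -[X in measurable X]setTI; exact: (mh measurableT).
    (* A path of X_alpha has a neighbourhood of finite measure, whereas every cylinder around a path
       that stays at a source is infinite; h cannot map one to the other. *)
    move=> x /not_class_paths[s xs] /(class_pathsP terminal)[j xj].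
    have cC : clopen (g @^-1` cylinder j x).
      by apply: preimage_clopen => //; exact: clopen_cylinder.
    have : mu (cylinder j x) = nu (g @^-1` cylinder j x) by rewrite -hnu // hg.
    have Cx : (g @^-1` cylinder j x) (h x) by move: (cyl_refl j x); rewrite -{2}[x]hK.
    have [/openP/(_ _ Cx)[n nC] _] := cC.
    have := le_content (augmented_contentP terminal eig k m) (clopen_cylinder n (h x)) cC nC.
    rewrite (augmented_content_cylinder eig) xs augmented_weight_source.
    by rewrite leye_eq => /eqP ->; rewrite cyl.
  - move=> n p pa; rewrite mu'E hnu; last exact: clopen_cylinder.
    by rewrite (augmented_content_cylinder eig) /augmented_weight pa.
exists mu'; split.
- split.
  + have l0 : 0 < lam by exact: lt_trans l1.
    case: eig' => _ _ _ null' cyl'; exact: (eigen_measure_invariant ct l0 null' cyl').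
  + apply: (eigen_measure_ergodic ct _ eig').
    exact: copies_primitive.
  + move=> U oU [y Uy]; rewrite mu'E; apply: full.
      by move/continuousP : ch; apply.
    by exists (g y); rewrite /preimage /= gK.
  + exists (copies terminal k m); split.
    * exact: (copies_class terminal k m prim a0).
    * by apply/(class_measureE ct); exists lam, (augmented_xi xi (terminal := terminal) (k := k) (m := m)).
    * by move=> v; exact: (augmented_classes a0 v).
- by rewrite /infinite_measure mu'E.
- move=> U V cU cV; rewrite !mu'E => UV.
  have [||W [cW WV mW]] := good _ _ UV; [exact: preimage_clopen|exact: preimage_clopen|].
  exists (g @^-1` W); split; first exact: preimage_clopen.
    by move=> y /WV; rewrite /preimage /= gK.
  by rewrite !mu'E hg.
- exists g; split; first by split=> //; exists h.
  by move=> A _; rewrite mu'E hg.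
Qed.

End realization.

(** A target in a class preceding alpha would lead back to alpha, and so would belong to the same
    component. *)
Lemma class_terminal B (alpha : {set vtx B}) : vertex_class alpha ->
  (forall v : vtx B, v \in alpha \/ exists beta : {set vtx B},
     [/\ vertex_class beta, class_prec beta alpha & v \in beta]) ->
  forall e : edge B, src e \in alpha -> tgt e \in alpha.
Proof.
move=> [u ->] cover e ue; have [//|[beta [[v ->] [_ [x [y [vx uy xy]]]] vt]]] := cover (tgt e).
rewrite !inE in ue vx uy vt *.
have /andP[ut _] := ue; have /andP[vx' _] := vx.
have /andP[_ yu] := uy; have /andP[_ tv] := vt.
have et : reach (src e) (tgt e) by apply: connect1; exact: inc_edge.
apply/andP; split; first exact: connect_trans ut et.
exact: connect_trans tv (connect_trans vx' (connect_trans xy yu)).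
Qed.

Theorem theorem3p8 (R : realType) (B : stationary_diagram)
    (mu : {measure set (borel_bpath B) -> \bar R}) :
  standing_assumptions B -> ~ simple_diagram B ->
  ergodic_invariant_measure mu -> infinite_measure mu -> good_measure mu ->
  exists (B_ : nat -> stationary_diagram)
    (mu_ : forall i, {measure set (borel_bpath (B_ i)) -> \bar R}),
    [/\ forall i, (1 <= i)%N ->
          [/\ standing_assumptions (B_ i), ergodic_invariant_measure (mu_ i),
              infinite_measure (mu_ i) & good_measure (mu_ i)],
        forall i, (1 <= i)%N -> homeomorphic_measures (mu_ i) mu,
        forall i j, (1 <= i)%N -> (1 <= j)%N ->
          (orbit_equivalent (B_ i) (B_ j) <-> i = j) &
        forall i, (1 <= i)%N ->
          [set C : set (bpath (B_ i)) | minimal_component C] #= `I_i].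
Proof.
move=> [_ blocks] _ [_ _ full [alpha [calpha ca cover]]] inf good.
have terminal := class_terminal calpha cover.
have [lam [xi eig]] := (class_measureE terminal mu).1 ca.
have [l1 xi0 Axi _ _] := eig.
have [u ualpha] : exists u, u \in alpha.
  by case: calpha => u ->; exists u; rewrite inE /reach connect0.
pose a0 : 'I_#|alpha| := enum_rank_in ualpha u.
have prim : primitive_mx (class_block alpha).
  (* A zero block would force lam * xi = 0. *)
  apply: blocks => // block0.
  have := Axi _ (enum_valP a0); rewrite (sum_edges_class terminal) big1.
    by move=> /esym/eqP; rewrite mulf_eq0 !gt_eqF ?xi0 ?enum_valP // (lt_trans _ l1).
  by move=> b _; rewrite block0 mxE.
pose m := Num.bound lam.
have lam_le : lam <= m.+2%:R.
  have l0 : 0 <= lam by rewrite ltW // (lt_trans _ l1).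
  by apply: (le_trans (ltW (archi_boundP l0))); rewrite ler_nat leqW.
(* [augmented] has one source more than its numerical argument k, hence [i.-1]; [B_ 0] merely
   repeats [B_ 1]. *)
pose B_ i := augmented terminal i.-1 m.
pose real i := augmented_measure terminal eig prim full inf good a0 i.-1 lam_le.
have minE i : (1 <= i)%N -> [set C : set (bpath (B_ i)) | minimal_component C] #= `I_i.
  by move=> i1; have := card_minimal_components terminal i.-1 m; rewrite prednK.
exists B_, (fun i => sval (cid (real i))); split=> //.
- move=> i i1; have [? ? ? ?] := svalP (cid (real i)); split=> //.
  exact: augmented_standing.
- by move=> i i1; have [] := svalP (cid (real i)).
- move=> i j i1 j1; split=> [oe|->]; last exact: orbit_equivalent_refl.
  apply/card_eq_II; apply: card_eq_trans (card_esym (minE i i1)) _.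
  exact: card_eq_trans (orbit_equivalent_minimal_components oe) (minE j j1).
Qed.
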